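(* Let $k\ge1$. Let $V_0,\dots,V_k$ be complex vector spaces, and let $W_0,\dots,W_k$ be complex Banach spaces, each equipped with an admissible system of rectangular matrix norms. Let $\Omega^{(j)}\subseteq V_{j,\mathrm{nc}}$, $j=0,\dots,k$, be finitely open, right admissible nc sets. Suppose that for $j=0,\dots,k$ the nc function $$F_j\in\mathcal T^{k+1}(\Omega^{(0)},\dots,\Omega^{(j-1)},\Omega^{(j)},\Omega^{(j)},\Omega^{(j+1)},\dots,\Omega^{(k)};W_{0,\mathrm{nc}},\dots,W_{j,\mathrm{nc}},V_{j,\mathrm{nc}},W_{j+1,\mathrm{nc}},\dots,W_{k,\mathrm{nc}})$$ is $W$-analytic on slices. Then there exists an nc function $f\in\mathcal T^k(\Omega^{(0)},\dots,\Omega^{(k)};W_{0,\mathrm{nc}},\dots,W_{k,\mathrm{nc}})$ which is $W$-analytic on slices and satisfies ${}_j\Delta f=F_j$ for $j=0,\dots,k$, if and only if ${}_i\Delta F_j={}_{j+1}\Delta F_i$ for all $0\le i\le j\le k$. Further, $f$ is uniquely determined up to a $k$-linear mapping: if $\tilde f$ is another such function, then there is a $k$-linear mapping $c:W_1\times\cdots\times W_k\to W_0$ such that $\tilde f(X^0,\dots,X^k)(Z^1,\dots,Z^k)=f(X^0,\dots,X^k)(Z^1,\dots,Z^k)+C(Z^1,\dots,Z^k)$, where for $X^j\in\Omega^{(j)}_{n_j}$, $Z^j\in W_j^{n_{j-1}\times n_j}$, the $(\alpha_0,\alpha_k)$ entry of $C(Z^1,\dots,Z^k)\in W_0^{n_0\times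 n_k}$ is $\sum_{\alpha_1=1}^{n_1}\cdots\sum_{\alpha_{k-1}=1}^{n_{k-1}}c(Z^1_{\alpha_0,\alpha_1},\dots,Z^k_{\alpha_{k-1},\alpha_k})$.
   Context: The ground ring is $R=\mathbb C$. For a complex vector space $V$, $V_{\mathrm{nc}}=\bigsqcup_{n\ge1}V^{n\times n}$. A subset $\Omega\subseteq V_{\mathrm{nc}}$ is an nc set if $X\oplus Y\in\Omega$ (block diagonal sum) whenever $X,Y\in\Omega$; $\Omega_n=\Omega\cap V^{n\times n}$. It is right admissible if for all $X\in\Omega_n$, $Y\in\Omega_m$, $Z\in V^{n\times m}$ there is a nonzero $r\in\mathbb C$ with $\begin{bmatrix}X&rZ\\ 0&Y\end{bmatrix}\in\Omega_{n+m}$. It is finitely open if for every $n$ the intersection of $\Omega_n$ with any finite-dimensional subspace $U$ of $V^{n\times n}$ is open in the Euclidean topology of $U$. An admissible system of rectangular matrix norms on a Banach space $W$: norms on all $W^{p\times q}$, $p,q\in\mathbb N$, such that for all $s_1,\dots,s_m\in\mathbb N$, $s=s_1+\dots+s_m$, the block injections $W^{s_\alpha\times s_\beta}\to W^{s\times s}$, $A\mapsto E_\alpha AE_\beta^\top$, and block projections $W^{s\times s}\to W^{s_\alpha\times s_\beta}$, $A\mapsto E_\alpha^\top AE_\beta$, are bounded, where $E_\alpha\in\mathbb C^{s\times s_\alpha}$ is the block column with $I_{s_\alpha}$ in the $\alpha$-th block and zeros elsewhere. nc functions of order $k\ge1$ (here $\Omega^{(j)}\subseteq V_{j,\mathrm{nc}}$,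 and $N_0,\dots,N_k$ are complex vector spaces): $f\in\mathcal T^k(\Omega^{(0)},\dots,\Omega^{(k)};N_{0,\mathrm{nc}},\dots,N_{k,\mathrm{nc}})$ means that for $X^j\in\Omega^{(j)}_{n_j}$, $f(X^0,\dots,X^k):N_1^{n_0\times n_1}\times\cdots\times N_k^{n_{k-1}\times n_k}\to N_0^{n_0\times n_k}$ is $k$-linear, and $f$ respects intertwinings (equivalently, direct sums and similarities): for complex matrices $T$ and all arguments of appropriate sizes, (i) $TX^0=\tilde X^0T$ implies $Tf(X^0,X^1,\dots,X^k)(Z^1,\dots,Z^k)=f(\tilde X^0,X^1,\dots,X^k)(TZ^1,Z^2,\dots,Z^k)$; (ii) for $0<j<k$, $TX^j=\tilde X^jT$ implies $f(\dots,X^j,\dots)(Z^1,\dots,Z^jT,Z^{j+1},\dots,Z^k)=f(\dots,\tilde X^j,\dots)(Z^1,\dots,Z^j,TZ^{j+1},\dots,Z^k)$; (iii) $TX^k=\tilde X^kT$ implies $f(\dots,X^k)(Z^1,\dots,Z^{k-1},Z^kT)=f(\dots,\tilde X^k)(Z^1,\dots,Z^k)T$. Difference-differential operators. For $f$ of order $k\ge1$ and $0\le j\le k$, ${}_j\Delta f$ is the nc function of order $k+1$ in which the $j$-th point argument is replaced by two points $X^j_1,X^j_2\in\Omega^{(j)}$ and a matrix argument $Z$ over $V_j$ is inserted after $Z^j$; writing $P=\begin{bmatrix}X^j_1&Z\\ 0&X^j_2\end{bmatrix}$, it is determined by ${}_0\Delta f(X^0_1,X^0_2,X^1,\dots,X^k)(Z,Z^1,\dots,Z^k)=\begin{bmatrix}I&0\end{bmatrix}f(P,X^1,\dots,X^k)\left(\begin{bmatrix}0\\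 Z^1\end{bmatrix},Z^2,\dots,Z^k\right)$; for $0<j<k$, ${}_j\Delta f(X^0,\dots,X^j_1,X^j_2,\dots,X^k)(Z^1,\dots,Z^j,Z,Z^{j+1},\dots,Z^k)=f(X^0,\dots,P,\dots,X^k)\left(Z^1,\dots,Z^{j-1},\begin{bmatrix}Z^j&0\end{bmatrix},\begin{bmatrix}0\\ Z^{j+1}\end{bmatrix},Z^{j+2},\dots,Z^k\right)$; ${}_k\Delta f(X^0,\dots,X^{k-1},X^k_1,X^k_2)(Z^1,\dots,Z^k,Z)=f(X^0,\dots,X^{k-1},P)(Z^1,\dots,Z^{k-1},\begin{bmatrix}Z^k&0\end{bmatrix})\begin{bmatrix}0\\ I\end{bmatrix}$. These are used when $P\in\Omega^{(j)}$; for general $Z$ one replaces $Z$ by $rZ$ with $r\ne0$ such that the block matrix lies in $\Omega^{(j)}$ and divides the result by $r$ (this is independent of $r$ and linear in $Z$). The operators ${}_i\Delta$ on functions of order $k+1$ are defined in the same way. $W$-analytic on slices: an nc function $f$ of order $\ell$ on $\Omega^{(0)}\times\cdots\times\Omega^{(\ell)}$ with values in matrices over a Banach space with an admissible system of matrix norms is $W$-analytic on slices if for all points $Y^j\in\Omega^{(j)}_{n_j}$, all directions $Z^j\in V_j^{n_j\times n_j}$ ($j=0,\dots,\ell$), and all fixed matrix arguments $W^1,\dots,W^\ell$ of appropriate sizes, $t\mapsto f(Y^0+tZ^0,\dots,Y^\ell+tZ^\ell)(W^1,\dots,W^\ell)$ is an analytic function of $t\in\mathbb C$ in a neighborhood of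 $0$. (Here the sets and vector spaces are those in the list appropriate to the function; for $F_j$ the set $\Omega^{(j)}$ is repeated and the $(j+1)$-st matrix argument is over $V_j$.) *)

(* Defs.v *)
(* Mathematical Components and MathComp-Analysis; the complex field is R[i]
   for R : realType. *)
From mathcomp Require Import all_boot all_order all_algebra complex.
From mathcomp Require Import boolp classical_sets functions reals.
From mathcomp Require Import topology normedtype.

Set Implicit Arguments.
Unset Strict Implicit.
Unset Printing Implicit Defensive.

Import Order.TTheory GRing.Theory Num.Theory.
Import numFieldNormedType.Exports.
Local Open Scope ring_scope.
Local Open Scope complex_scope.
Local Open Scope classical_set_scope.

Section NC.
Variable R : realType.
Local Notation C := R[i].

(* Matrices over a vector space V, as a bimodule over complex matrices.  The
   library has such operations only for matrices over rings. *)

Definition scalemxV (V : lmodType C) m n (a : C) (X : 'M[V]_(m, n)) :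
  'M[V]_(m, n) := map_mx (fun v => a *: v) X.

Definition lmulmxV (V : lmodType C) m n p (T : 'M[C]_(m, n))
    (X : 'M[V]_(n, p)) : 'M[V]_(m, p) :=
  \matrix_(i, j) \sum_k T i k *: X k j.

Definition rmulmxV (V : lmodType C) m n p (X : 'M[V]_(m, n))
    (T : 'M[C]_(n, p)) : 'M[V]_(m, p) :=
  \matrix_(i, j) \sum_k T k j *: X i k.

(* Right admissible nc subsets of V_nc.  Matrices of size 0 do not belong to
   V_nc, whence ncdom_gt0. *)

Record ncdom (V : lmodType C) := NcDom {
  ncdom_car :> forall n, set 'M[V]_n ;
  ncdom_gt0 : forall n (X : 'M[V]_n), ncdom_car X -> (0 < n)%N ;
  ncdom_dsum : forall n m (X : 'M[V]_n) (Y : 'M[V]_m),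
    ncdom_car X -> ncdom_car Y -> ncdom_car (block_mx X 0 0 Y) ;
  ncdom_radm : forall n m (X : 'M[V]_n) (Y : 'M[V]_m) (Z : 'M[V]_(n, m)),
    ncdom_car X -> ncdom_car Y ->
    exists r : C, r != 0 /\ ncdom_car (block_mx X (scalemxV r Z) 0 Y)
}.

(* A finite-dimensional subspace U is given by a basis b, which identifies U
   with C^d; C^o is C with its usual topology. *)
Definition finitely_open (V : lmodType C) (Om : ncdom V) : Prop :=
  forall n d (b : 'I_d -> 'M[V]_n),
    (forall c : 'I_d -> C,
       \sum_(i < d) scalemxV (c i) (b i) = 0 -> forall i, c i = 0) ->
    open [set c : 'rV[C^o]_d | Om n (\sum_(i < d) scalemxV (c 0 i) (b i))].

(* Systems of rectangular matrix norms.  As everywhere in the library, norms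
   of complex spaces take their (real, nonnegative) values in C. *)

Definition is_norm (W : lmodType C) p q (N : 'M[W]_(p, q) -> C) : Prop :=
  [/\ forall A B, N (A + B) <= N A + N B,
      forall a A, N (scalemxV a A) = `|a| * N A
    & forall A, N A = 0 -> A = 0].

(* E_alpha, of size (s_1 + ... + s_m) x s_alpha: tagnat.Rank a j is the
   position of the j-th index of the a-th block. *)
Definition block_col m (s : 'I_m -> nat) (a : 'I_m) :
  'M[C]_(\sum_b s b, s a) :=
  \matrix_(i, j) (i == tagnat.Rank a j)%:R.

Definition matnorms (W : lmodType C) := forall p q, 'M[W]_(p, q) -> C.

Definition admissible_norms (W : completeNormedModType C) (N : matnorms W) :
    Prop :=
  [/\ forall p q, (0 < p)%N -> (0 < q)%N -> is_norm (@N p q),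
      forall w : W, N 1%N 1%N (const_mx w) = `|w|
    & forall m (s : 'I_m -> nat), (forall a, (0 < s a)%N) -> forall a b,
      (exists K : C, forall A : 'M[W]_(s a, s b),
         N _ _ (rmulmxV (lmulmxV (block_col s a) A) (block_col s b)^T)
           <= K * N _ _ A)
      /\
      (exists K : C, forall A : 'M[W]_(\sum_c s c, \sum_c s c),
         N _ _ (rmulmxV (lmulmxV (block_col s a)^T A) (block_col s b))
           <= K * N _ _ A)].

(* A point of Om: a matrix in Om together with its size. *)
Record ncpoint (V : lmodType C) (Om : ncdom V) := NcPoint {
  psize : nat ;
  pval :> 'M[V]_psize ;
  pval_in : Om psize pval
}.

(* A function of order k on Om_0 x ... x Om_k with values k-linear maps from
   N_1^(n_0 x n_1) x ... x N_k^(n_(k-1) x n_k) to N_0^(n_0 x n_k) is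
   represented in curried form, with its arguments in the order
     X^0, X^1, Z^1, X^2, Z^2, ..., X^k, Z^k.
   Its type is determined by Om_0, N_0 and the list of the slots (N_i, Om_i)
   for i = 1, ..., k. *)

Record slot := Slot {
  sN : lmodType C ;
  sV : lmodType C ;
  sOm : ncdom sV
}.

(* Curried functions of the pairs (X^i, Z^i) in the given slots, when the
   previous point has size p; the type of the values depends on the size of
   the last point. *)
Fixpoint tele (A : nat -> Type) (l : seq slot) (p : nat) : Type :=
  match l with
  | [::] => A p
  | s :: l' => forall X : ncpoint (sOm s), 'M[sN s]_(p, psize X) ->
      tele A l' (psize X)
  end.

Definition mxrows (N : lmodType C) (m : nat) : nat -> Type :=
  fun n => 'M[N]_(m, n).

Definition ncfun (N0 V0 : lmodType C) (Om0 : ncdom V0) (l : seq slot) : Type :=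
  forall X0 : ncpoint Om0, tele (mxrows N0 (psize X0)) l (psize X0).

Fixpoint tele_map (A B : nat -> Type) (h : forall n, A n -> B n) l p {struct l} :
    tele A l p -> tele B l p :=
  match l with
  | [::] => h p
  | s :: l' => fun f X Z => tele_map h (f X Z)
  end.

Fixpoint tele_add (N0 : lmodType C) m l p {struct l} :
    tele (mxrows N0 m) l p -> tele (mxrows N0 m) l p ->
    tele (mxrows N0 m) l p :=
  match l with
  | [::] => fun M M' : 'M[N0]_(m, p) => M + M'
  | s :: l' => fun f g X Z => tele_add (f X Z) (g X Z)
  end.

Definition tele_scale (N0 : lmodType C) m (a : C) l p :
    tele (mxrows N0 m) l p -> tele (mxrows N0 m) l p :=
  @tele_map _ _ (fun n => @scalemxV N0 m n a) l p.

Definition tele_lmul (N0 : lmodType C) m m' (T : 'M[C]_(m', m)) l p :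
    tele (mxrows N0 m) l p -> tele (mxrows N0 m') l p :=
  @tele_map _ _ (fun n => @lmulmxV N0 m' m n T) l p.

(* Multiplication by T on the left of the next matrix argument Z or, when no
   argument is left, on the right of the value. *)
Definition tele_absorb (N0 : lmodType C) m p p' (T : 'M[C]_(p', p)) l :
    tele (mxrows N0 m) l p' -> tele (mxrows N0 m) l p :=
  match l with
  | [::] => fun M : 'M[N0]_(m, p') => rmulmxV M T
  | s :: l' => fun f X Z => f X (lmulmxV T Z)
  end.

Fixpoint multilinear (N0 : lmodType C) m l p {struct l} :
    tele (mxrows N0 m) l p -> Prop :=
  match l with
  | [::] => fun=> True
  | s :: l' => fun f =>
      forall X : ncpoint (sOm s),
        [/\ forall Z Z', f X (Z + Z') = tele_add (f X Z) (f X Z'),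
            forall a Z, f X (scalemxV a Z) = tele_scale a (f X Z)
          & forall Z, multilinear (f X Z)]
  end.

Definition intertwines (V : lmodType C) (Om : ncdom V) (X X' : ncpoint Om)
    (T : 'M[C]_(psize X', psize X)) : Prop :=
  lmulmxV T X = rmulmxV X' T.

(* Compatibility with the intertwinings T X^j = X'^j T for j > 0: T passes from
   Z^j to Z^(j+1) if j < k, and to the right of the value if j = k. *)
Fixpoint respects_right (N0 : lmodType C) m l p {struct l} :
    tele (mxrows N0 m) l p -> Prop :=
  match l with
  | [::] => fun=> True
  | s :: l' => fun f =>
      (forall (X X' : ncpoint (sOm s)) (T : 'M[C]_(psize X', psize X)),
         intertwines T -> forall Z : 'M[sN s]_(p, psize X'),
         f X (rmulmxV Z T) = tele_absorb T (f X' Z))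
      /\ forall X Z, respects_right (f X Z)
  end.

Definition is_nc (N0 V0 : lmodType C) (Om0 : ncdom V0) l
    (f : ncfun N0 Om0 l) : Prop :=
  [/\ forall X, multilinear (f X),
      forall (X X' : ncpoint Om0) (T : 'M[C]_(psize X', psize X)),
        intertwines T -> tele_lmul T (f X) = tele_absorb T (f X')
    & forall X, respects_right (f X)].

(* The slots of j_Delta f: the point X^j is followed by a second point over
   V_j, together with a matrix argument over V_j. *)

Fixpoint dup_right (j : nat) (l : seq slot) {struct l} : seq slot :=
  match l with
  | [::] => [::]
  | s :: l' =>
      match j with
      | 0%N => [:: s, Slot (sV s) (sOm s) & l']
      | j'.+1 => s :: dup_right j' l'
      end
  end.

Definition dup (V0 : lmodType C) (Om0 : ncdom V0) (j : nat) (l : seq slot) :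
    seq slot :=
  match j with
  | 0%N => Slot V0 Om0 :: l
  | j'.+1 => dup_right j' l
  end.

Definition inj_low n1 n2 : 'M[C]_(n1 + n2, n2) := col_mx 0 1%:M.
Definition proj_up n1 n2 : 'M[C]_(n1, n1 + n2) := row_mx 1%:M 0.

(* The value of g at [X1, r Z; 0, X2], divided by r, for some nonzero r such
   that this matrix lies in Om. *)
Definition at_block (V : lmodType C) (Om : ncdom V) (X1 X2 : ncpoint Om)
    (Z : 'M[V]_(psize X1, psize X2)) (N0 : lmodType C) m l p
    (g : forall P : 'M[V]_(psize X1 + psize X2), Om _ P ->
       tele (mxrows N0 m) l p) : tele (mxrows N0 m) l p :=
  let r := cid (ncdom_radm Z (pval_in X1) (pval_in X2)) in
  tele_scale (sval r)^-1 (g _ (svalP r).2).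

Fixpoint Delta_right (N0 : lmodType C) m (j : nat) l p {struct l} :
    tele (mxrows N0 m) l p -> tele (mxrows N0 m) (dup_right j l) p :=
  match l return
      tele (mxrows N0 m) l p -> tele (mxrows N0 m) (dup_right j l) p with
  | [::] => fun f => f
  | s :: l' =>
      match j return
          tele (mxrows N0 m) (s :: l') p ->
          tele (mxrows N0 m) (dup_right j (s :: l')) p with
      | 0%N => fun f X1 Zj X2 Z =>
          at_block Z (fun P hP =>
            tele_absorb (inj_low (psize X1) (psize X2))
              (f (NcPoint hP) (row_mx Zj 0)))
      | j'.+1 => fun f X Z => Delta_right j' (f X Z)
      end
  end.

Definition Delta (N0 V0 : lmodType C) (Om0 : ncdom V0) (j : nat) l :
    ncfun N0 Om0 l -> ncfun N0 Om0 (dup Om0 j l) :=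
  match j return ncfun N0 Om0 l -> ncfun N0 Om0 (dup Om0 j l) with
  | 0%N => fun f X1 X2 Z =>
      tele_lmul (proj_up (psize X1) (psize X2))
        (at_block Z (fun P hP =>
           tele_absorb (inj_low (psize X1) (psize X2)) (f (NcPoint hP))))
  | j'.+1 => fun f X0 => Delta_right j' (f X0)
  end.

(* The two sides of i_Delta F_j = (j+1)_Delta F_i have the same slots, so that
   this equation makes sense as an equality of dependent pairs. *)
Lemma dup_dup (V0 : lmodType C) (Om0 : ncdom V0) (i j : nat) (l : seq slot) :
  (i <= j <= size l)%N ->
  dup Om0 i (dup Om0 j l) = dup Om0 j.+1 (dup Om0 i l).
Proof.
have dup_right2 a b m : (a <= b)%N -> (b < size m)%N ->
    dup_right a (dup_right b m) = dup_right b.+1 (dup_right a m).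
  by elim: m a b => [|s m IH] [|a] [|b] //= ab bm; rewrite IH.
case: i j => [|i] [|j] //= /andP[ij jl].
exact: dup_right2.
Qed.

Definition nc_eq (N0 V0 : lmodType C) (Om0 : ncdom V0) (l l' : seq slot)
    (f : ncfun N0 Om0 l) (g : ncfun N0 Om0 l') : Prop :=
  existT (ncfun N0 Om0) l f = existT (ncfun N0 Om0) l' g.

(* A partial function g on C, defined where D holds, is analytic near 0 if it
   is defined on some disc around 0 and given there by a power series
   converging for the norm nrm. *)
Definition analytic_near0 (N0 : lmodType C) m n (nrm : 'M[N0]_(m, n) -> C)
    (D : C -> Prop) (g : forall t, D t -> 'M[N0]_(m, n)) : Prop :=
  exists (rho : C) (a : nat -> 'M[N0]_(m, n)), 0 < rho /\
    forall t : C, `|t| < rho -> exists h : D t,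
      (fun M : nat =>
         nrm (g t h - \sum_(i < M) scalemxV (t ^+ i) (a i)) : C^o)
        @ \oo --> (0 : C^o).

(* Along a slice, the points Y^i + t Z^i belong to Om_i only for some t: the
   predicate D collects these conditions. *)
Fixpoint slice_analytic (N0 : lmodType C) (nu : matnorms N0) m l p
    (D : C -> Prop) {struct l} :
    (forall t, D t -> tele (mxrows N0 m) l p) -> Prop :=
  match l with
  | [::] => fun g => analytic_near0 (nu m p) g
  | s :: l' => fun g =>
      forall (Y : ncpoint (sOm s)) (Z : 'M[sV s]_(psize Y))
             (Wm : 'M[sN s]_(p, psize Y)),
        slice_analytic nu
          (D := fun t => D t /\ sOm s (psize Y) (pval Y + scalemxV t Z))
          (fun t h => g t h.1 (NcPoint h.2) Wm)
  end.

Definition W_analytic (N0 V0 : lmodType C) (nu : matnorms N0) (Om0 : ncdom V0)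
    l (f : ncfun N0 Om0 l) : Prop :=
  forall (Y : ncpoint Om0) (Z : 'M[V0]_(psize Y)),
    slice_analytic nu
      (D := fun t => Om0 (psize Y) (pval Y + scalemxV t Z))
      (fun t h => f (NcPoint h)).

(* Curried maps N_1 -> ... -> N_k -> N_0, with pointwise operations. *)
Fixpoint curried (N0 : lmodType C) (l : seq slot) : lmodType C :=
  match l with
  | [::] => N0
  | s :: l' => (sN s -> curried N0 l') : lmodType C
  end.

Fixpoint klinear (N0 : lmodType C) (l : seq slot) : curried N0 l -> Prop :=
  match l with
  | [::] => fun=> True
  | s :: l' => fun c : sN s -> curried N0 l' =>
      (forall a z z', c (a *: z + z') = a *: c z + c z')
      /\ forall z, klinear (c z)
  end.

(* G al be is the sum over the previous intermediate indices of the partial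
   applications of c; the next step sums over be =: ga. *)
Fixpoint sum_ext (N0 : lmodType C) m l p {struct l} :
    ('I_m -> 'I_p -> curried N0 l) -> tele (mxrows N0 m) l p :=
  match l with
  | [::] => fun G : 'I_m -> 'I_p -> N0 => \matrix_(al, be) G al be
  | s :: l' => fun (G : 'I_m -> 'I_p -> sN s -> curried N0 l') X Z =>
      sum_ext (fun al be => \sum_(ga < p) G al ga (Z ga be))
  end.

(* C(Z^1, ..., Z^k).  For k = 0, which is not used, it is c tensor I_m. *)
Definition mx_ext (N0 : lmodType C) m l : curried N0 l ->
    tele (mxrows N0 m) l m :=
  match l with
  | [::] => fun c : N0 => \matrix_(al, be) (if al == be then c else 0)
  | s :: l' => fun (c : sN s -> curried N0 l') X Z =>
      sum_ext (fun al be => c (Z al be))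
  end.

(* The slots (W_i, Om_i), i = 1, ..., k. *)
Definition slots k (V W : 'I_k.+1 -> lmodType C) (Om : forall j, ncdom (V j)) :
    seq slot :=
  [seq Slot (W (lift ord0 i)) (Om (lift ord0 i)) | i <- enum 'I_k].

End NC.

(* Main.v *)
From HB Require Import structures.
Require Import Defs.
From mathcomp Require Import all_boot all_order all_algebra complex.
From mathcomp Require Import boolp classical_sets functions reals.
From mathcomp Require Import topology normedtype sequences.

Set Implicit Arguments.
Unset Strict Implicit.
Unset Printing Implicit Defensive.

Import Order.TTheory GRing.Theory Num.Theory.
Import numFieldNormedType.Exports.
Local Open Scope ring_scope.
Local Open Scope complex_scope.

(* If f is an nc function and T is any matrix, then
     f(X)(Z T, Z') = f(X')(Z, T Z') + (Delta f)(X', X)(Z, T X - X' T, Z')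
   in each slot.  Conversely such difference formulas, with F_j in place of
   Delta_j f, say exactly that f is nc and Delta_j f = F_j.

   Existence needs no integration.  Fix a point Y and an index i0, and write
   I = sum_a T_a S_a with S_a = delta_mx i0 a and T_a = delta_mx a i0, so that
   S_a goes from X to Y.  The formula for T = S_a forces
     f(X)(Z, Z') = sum_a f(Y)(Z T_a, S_a Z')
                   + F(Y, X)(Z T_a, S_a X - Y S_a, Z'),
   so that f is determined, slot by slot, by the value c of f at the base
   points on the corner entries, which may be chosen to be 0.  That this f has
   the required differences is the cocycle identity
     F(Y, X)(z, U T X - Y U T, Z') = F(Y, X')(z, U X' - Y U, T Z')
                                     + F(X', X)(z U, T X - X' T, Z'),
   which is the closedness condition.  Analyticity comes from
   f(Y + tZ) = f(Y) + t F(Y, Y + tZ)(Z), applied in one slot after another.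
   The difference of two solutions satisfies the difference formulas with
   F = 0, so it is determined by its corner entries c. *)

(** * Matrices over a complex vector space *)

Section MatrixModule.
Variables (R : realType) (V : lmodType R[i]).
Local Notation C := R[i].

Lemma lmulmxVDl m n p (S T : 'M[C]_(m, n)) (X : 'M[V]_(n, p)) :
  lmulmxV (S + T) X = lmulmxV S X + lmulmxV T X.
Proof.
apply/matrixP => i j; rewrite !mxE -big_split /=.
by apply: eq_bigr => k _; rewrite mxE scalerDl.
Qed.

Lemma lmulmxVDr m n p (T : 'M[C]_(m, n)) (X Y : 'M[V]_(n, p)) :
  lmulmxV T (X + Y) = lmulmxV T X + lmulmxV T Y.
Proof.
apply/matrixP => i j; rewrite !mxE -big_split /=.
by apply: eq_bigr => k _; rewrite mxE scalerDr.
Qed.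

Lemma lmulmxVZl m n p a (T : 'M[C]_(m, n)) (X : 'M[V]_(n, p)) :
  lmulmxV (a *: T) X = scalemxV a (lmulmxV T X).
Proof.
apply/matrixP => i j; rewrite !mxE scaler_sumr.
by apply: eq_bigr => k _; rewrite mxE scalerA.
Qed.

Lemma lmulmxVZr m n p a (T : 'M[C]_(m, n)) (X : 'M[V]_(n, p)) :
  lmulmxV T (scalemxV a X) = scalemxV a (lmulmxV T X).
Proof.
apply/matrixP => i j; rewrite !mxE scaler_sumr.
by apply: eq_bigr => k _; rewrite mxE !scalerA mulrC.
Qed.

Lemma lmulmxVA m n p q (S : 'M[C]_(m, n)) (T : 'M[C]_(n, p))
    (X : 'M[V]_(p, q)) :
  lmulmxV S (lmulmxV T X) = lmulmxV (S *m T) X.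
Proof.
apply/matrixP => i j; rewrite !mxE.
under eq_bigr => k _ do rewrite mxE scaler_sumr.
rewrite exchange_big /=; apply: eq_bigr => l _.
by rewrite mxE scaler_suml; apply: eq_bigr => k _; rewrite scalerA.
Qed.

Lemma lmul1mxV n p (X : 'M[V]_(n, p)) : lmulmxV 1%:M X = X.
Proof.
apply/matrixP => i j; rewrite mxE (bigD1 i) //= mxE eqxx scale1r.
rewrite big1 ?addr0 // => k; rewrite mxE eq_sym => /negPf->.
by rewrite scale0r.
Qed.

Lemma rmulmxVDl m n p (X Y : 'M[V]_(m, n)) (T : 'M[C]_(n, p)) :
  rmulmxV (X + Y) T = rmulmxV X T + rmulmxV Y T.
Proof.
apply/matrixP => i j; rewrite !mxE -big_split /=.
by apply: eq_bigr => k _; rewrite mxE scalerDr.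
Qed.

Lemma rmulmxVDr m n p (X : 'M[V]_(m, n)) (S T : 'M[C]_(n, p)) :
  rmulmxV X (S + T) = rmulmxV X S + rmulmxV X T.
Proof.
apply/matrixP => i j; rewrite !mxE -big_split /=.
by apply: eq_bigr => k _; rewrite mxE scalerDl.
Qed.

Lemma rmulmxVZl m n p a (X : 'M[V]_(m, n)) (T : 'M[C]_(n, p)) :
  rmulmxV (scalemxV a X) T = scalemxV a (rmulmxV X T).
Proof.
apply/matrixP => i j; rewrite !mxE scaler_sumr.
by apply: eq_bigr => k _; rewrite mxE !scalerA mulrC.
Qed.

Lemma rmulmxVZr m n p a (X : 'M[V]_(m, n)) (T : 'M[C]_(n, p)) :
  rmulmxV X (a *: T) = scalemxV a (rmulmxV X T).
Proof.
apply/matrixP => i j; rewrite !mxE scaler_sumr.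
by apply: eq_bigr => k _; rewrite mxE scalerA.
Qed.

Lemma rmulmxVA m n p q (X : 'M[V]_(m, n)) (S : 'M[C]_(n, p))
    (T : 'M[C]_(p, q)) :
  rmulmxV (rmulmxV X S) T = rmulmxV X (S *m T).
Proof.
apply/matrixP => i j; rewrite !mxE.
under eq_bigr => k _ do rewrite mxE scaler_sumr.
rewrite exchange_big /=; apply: eq_bigr => l _.
by rewrite mxE scaler_suml; apply: eq_bigr => k _; rewrite scalerA mulrC.
Qed.

Lemma rmulmxV1 m n (X : 'M[V]_(m, n)) : rmulmxV X 1%:M = X.
Proof.
apply/matrixP => i j; rewrite mxE (bigD1 j) //= mxE eqxx scale1r.
rewrite big1 ?addr0 // => k; rewrite mxE => /negPf->.
by rewrite scale0r.
Qed.

Lemma lrmulmxVA m n p q (S : 'M[C]_(m, n)) (X : 'M[V]_(n, p))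
    (T : 'M[C]_(p, q)) :
  rmulmxV (lmulmxV S X) T = lmulmxV S (rmulmxV X T).
Proof.
apply/matrixP => i j; rewrite !mxE.
under eq_bigr => k _ do rewrite mxE scaler_sumr.
rewrite exchange_big /=; apply: eq_bigr => l _.
rewrite mxE scaler_sumr; apply: eq_bigr => k _.
by rewrite !scalerA mulrC.
Qed.

Lemma scalemxVDr m n a (X Y : 'M[V]_(m, n)) :
  scalemxV a (X + Y) = scalemxV a X + scalemxV a Y.
Proof. by apply/matrixP => i j; rewrite !mxE scalerDr. Qed.

Lemma scalemxVDl m n a b (X : 'M[V]_(m, n)) :
  scalemxV (a + b) X = scalemxV a X + scalemxV b X.
Proof. by apply/matrixP => i j; rewrite !mxE scalerDl. Qed.

Lemma scalemxVA m n a b (X : 'M[V]_(m, n)) :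
  scalemxV a (scalemxV b X) = scalemxV (a * b) X.
Proof. by apply/matrixP => i j; rewrite !mxE scalerA. Qed.

Lemma scale1mxV m n (X : 'M[V]_(m, n)) : scalemxV 1 X = X.
Proof. by apply/matrixP => i j; rewrite !mxE scale1r. Qed.

Lemma scale0mxV m n (X : 'M[V]_(m, n)) : scalemxV 0 X = 0.
Proof. by apply/matrixP => i j; rewrite !mxE scale0r. Qed.

Lemma scaleNmxV m n a (X : 'M[V]_(m, n)) : scalemxV (- a) X = - scalemxV a X.
Proof. by apply/matrixP => i j; rewrite !mxE scaleNr. Qed.

Lemma scalemxVN m n a (X : 'M[V]_(m, n)) : scalemxV a (- X) = - scalemxV a X.
Proof. by apply/matrixP => i j; rewrite !mxE scalerN. Qed.

Lemma scalemxV0 m n a : scalemxV a (0 : 'M[V]_(m, n)) = 0.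
Proof. by apply/matrixP => i j; rewrite !mxE scaler0. Qed.

Lemma scalemxV_sum m n a I (r : seq I) (P : pred I) (X : I -> 'M[V]_(m, n)) :
  scalemxV a (\sum_(i <- r | P i) X i) = \sum_(i <- r | P i) scalemxV a (X i).
Proof.
apply: (big_morph (scalemxV a)); last exact: scalemxV0.
exact: scalemxVDr.
Qed.

Lemma lmulmxV0 m n p (T : 'M[C]_(m, n)) : lmulmxV T (0 : 'M[V]_(n, p)) = 0.
Proof. by rewrite -(scalemxV0 _ _ 0) lmulmxVZr scale0mxV. Qed.

Lemma lmul0mxV m n p (X : 'M[V]_(n, p)) : lmulmxV (0 : 'M[C]_(m, n)) X = 0.
Proof. by rewrite -(scale0r 0) lmulmxVZl scale0mxV. Qed.

Lemma rmulmxV0 m n p (X : 'M[V]_(m, n)) : rmulmxV X (0 : 'M[C]_(n, p)) = 0.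
Proof. by rewrite -(scale0r 0) rmulmxVZr scale0mxV. Qed.

Lemma rmulmxV_sum m n p (X : 'M[V]_(m, n)) I (r : seq I) (P : pred I)
    (T : I -> 'M[C]_(n, p)) :
  rmulmxV X (\sum_(i <- r | P i) T i) = \sum_(i <- r | P i) rmulmxV X (T i).
Proof.
apply: (big_morph (rmulmxV X)); last exact: rmulmxV0.
exact: rmulmxVDr.
Qed.

Lemma lmulmxVN m n p (T : 'M[C]_(m, n)) (X : 'M[V]_(n, p)) :
  lmulmxV T (- X) = - lmulmxV T X.
Proof. by apply/eqP; rewrite -addr_eq0 -lmulmxVDr addNr lmulmxV0. Qed.

Lemma rmulNmxV m n p (X : 'M[V]_(m, n)) (T : 'M[C]_(n, p)) :
  rmulmxV (- X) T = - rmulmxV X T.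
Proof.
apply/eqP; rewrite -addr_eq0 -rmulmxVDl addNr.
by rewrite -(scalemxV0 _ _ 0) rmulmxVZl scale0mxV.
Qed.

Lemma lmul_col_mxV m1 m2 n p (A : 'M[C]_(m1, n)) (B : 'M[C]_(m2, n))
    (X : 'M[V]_(n, p)) :
  lmulmxV (col_mx A B) X = col_mx (lmulmxV A X) (lmulmxV B X).
Proof.
apply/matrixP => i j; case: (split_ordP i) => k ->;
  rewrite ?(col_mxEu, col_mxEd) !mxE;
  by apply: eq_bigr => l _; rewrite ?(col_mxEu, col_mxEd).
Qed.

Lemma rmul_mxV_row m n p1 p2 (X : 'M[V]_(m, n)) (A : 'M[C]_(n, p1))
    (B : 'M[C]_(n, p2)) :
  rmulmxV X (row_mx A B) = row_mx (rmulmxV X A) (rmulmxV X B).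
Proof.
apply/matrixP => i j; case: (split_ordP j) => k ->;
  rewrite ?(row_mxEl, row_mxEr) !mxE;
  by apply: eq_bigr => l _; rewrite ?(row_mxEl, row_mxEr).
Qed.

Lemma lmul_row_colV m n1 n2 p (A : 'M[C]_(m, n1)) (B : 'M[C]_(m, n2))
    (X : 'M[V]_(n1, p)) (Y : 'M[V]_(n2, p)) :
  lmulmxV (row_mx A B) (col_mx X Y) = lmulmxV A X + lmulmxV B Y.
Proof.
apply/matrixP => i j; rewrite !mxE big_split_ord /=.
by congr (_ + _); apply: eq_bigr => k _;
  rewrite ?(row_mxEl, row_mxEr) ?(col_mxEu, col_mxEd).
Qed.

Lemma rmul_row_colV m n1 n2 p (X : 'M[V]_(m, n1)) (Y : 'M[V]_(m, n2))
    (A : 'M[C]_(n1, p)) (B : 'M[C]_(n2, p)) :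
  rmulmxV (row_mx X Y) (col_mx A B) = rmulmxV X A + rmulmxV Y B.
Proof.
apply/matrixP => i j; rewrite !mxE big_split_ord /=.
by congr (_ + _); apply: eq_bigr => k _;
  rewrite ?(row_mxEl, row_mxEr) ?(col_mxEu, col_mxEd).
Qed.

Lemma lmul_mxV_row m n p1 p2 (T : 'M[C]_(m, n)) (X : 'M[V]_(n, p1))
    (Y : 'M[V]_(n, p2)) :
  lmulmxV T (row_mx X Y) = row_mx (lmulmxV T X) (lmulmxV T Y).
Proof.
apply/matrixP => i j; case: (split_ordP j) => k ->;
  rewrite ?(row_mxEl, row_mxEr) !mxE;
  by apply: eq_bigr => l _; rewrite ?(row_mxEl, row_mxEr).
Qed.

Lemma rmul_col_mxV m1 m2 n p (X : 'M[V]_(m1, n)) (Y : 'M[V]_(m2, n))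
    (T : 'M[C]_(n, p)) :
  rmulmxV (col_mx X Y) T = col_mx (rmulmxV X T) (rmulmxV Y T).
Proof.
apply/matrixP => i j; case: (split_ordP i) => k ->;
  rewrite ?(col_mxEu, col_mxEd) !mxE;
  by apply: eq_bigr => l _; rewrite ?(col_mxEu, col_mxEd).
Qed.

Lemma rmul0mxV m n p (T : 'M[C]_(n, p)) : rmulmxV (0 : 'M[V]_(m, n)) T = 0.
Proof. by rewrite -(scalemxV0 _ _ 0) rmulmxVZl scale0mxV. Qed.

End MatrixModule.

(** * Curried multilinear functions as a module *)

Section TeleModule.
Variables (R : realType) (N0 : lmodType R[i]).
Local Notation C := R[i].
Local Notation tel m l p := (tele (mxrows N0 m) l p).
Implicit Types (l : seq (slot R)) (m p : nat).

Fixpoint tele0 m l p : tel m l p :=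
  match l return tel m l p with
  | [::] => (0 : 'M[N0]_(m, p))
  | s :: l' => fun X _ => tele0 m l' (psize X)
  end.

Fixpoint tele_opp m l p : tel m l p -> tel m l p :=
  match l return tel m l p -> tel m l p with
  | [::] => fun M : 'M[N0]_(m, p) => - M
  | s :: l' => fun f X Z => tele_opp (f X Z)
  end.

Fact tele_addA m l p : associative (@tele_add R N0 m l p).
Proof.
elim: l p => [|s l IH] p /= f g h; first exact: addrA.
by apply: functional_extensionality_dep => X; apply/funext => Z; exact: IH.
Qed.

Fact tele_addC m l p : commutative (@tele_add R N0 m l p).
Proof.
elim: l p => [|s l IH] p /= f g; first exact: addrC.
by apply: functional_extensionality_dep => X; apply/funext => Z; exact: IH.
Qed.

Fact tele_add0 m l p : left_id (tele0 m l p) (@tele_add R N0 m l p).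
Proof.
elim: l p => [|s l IH] p /= f; first exact: add0r.
by apply: functional_extensionality_dep => X; apply/funext => Z; exact: IH.
Qed.

Fact tele_addN m l p :
  left_inverse (tele0 m l p) (@tele_opp m l p) (@tele_add R N0 m l p).
Proof.
elim: l p => [|s l IH] p /= f; first exact: addNr.
by apply: functional_extensionality_dep => X; apply/funext => Z; exact: IH.
Qed.

Fact tele_scaleA m l p a b (f : tel m l p) :
  tele_scale a (tele_scale b f) = tele_scale (a * b) f.
Proof.
elim: l p f => [|s l IH] p /= f; first exact: scalemxVA.
by apply: functional_extensionality_dep => X; apply/funext => Z; exact: IH.
Qed.

Fact tele_scale1 m l p (f : tel m l p) : tele_scale 1 f = f.
Proof.
elim: l p f => [|s l IH] p /= f; first exact: scale1mxV.
by apply: functional_extensionality_dep => X; apply/funext => Z; exact: IH.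
Qed.

Fact tele_scaleDr m l p a (f g : tel m l p) :
  tele_scale a (tele_add f g) = tele_add (tele_scale a f) (tele_scale a g).
Proof.
elim: l p f g => [|s l IH] p /= f g; first exact: scalemxVDr.
by apply: functional_extensionality_dep => X; apply/funext => Z; exact: IH.
Qed.

Fact tele_scaleDl m l p (f : tel m l p) a b :
  tele_scale (a + b) f = tele_add (tele_scale a f) (tele_scale b f).
Proof.
elim: l p f => [|s l IH] p /= f; first exact: scalemxVDl.
by apply: functional_extensionality_dep => X; apply/funext => Z; exact: IH.
Qed.

End TeleModule.

(** Addition and scaling act on values, so evaluating a sum at [X Z] is a conversion. Equality and
    choice come from classical logic; the module structure gives access to finite sums. *)
HB.instance Definition _ (R : realType) (N0 : lmodType R[i]) m
    (l : seq (slot R)) p :=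
  gen_eqMixin (tele (mxrows N0 m) l p).
HB.instance Definition _ (R : realType) (N0 : lmodType R[i]) m
    (l : seq (slot R)) p :=
  gen_choiceMixin (tele (mxrows N0 m) l p).
HB.instance Definition _ (R : realType) (N0 : lmodType R[i]) m
    (l : seq (slot R)) p :=
  GRing.isZmodule.Build (tele (mxrows N0 m) l p)
    (@tele_addA R N0 m l p) (@tele_addC R N0 m l p)
    (@tele_add0 R N0 m l p) (@tele_addN R N0 m l p).
HB.instance Definition _ (R : realType) (N0 : lmodType R[i]) m
    (l : seq (slot R)) p :=
  GRing.Zmodule_isLmodule.Build R[i] (tele (mxrows N0 m) l p)
    (@tele_scaleA R N0 m l p) (@tele_scale1 R N0 m l p)
    (@tele_scaleDr R N0 m l p) (@tele_scaleDl R N0 m l p).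

Section TeleTheory.
Variables (R : realType) (N0 : lmodType R[i]).
Local Notation C := R[i].
Local Notation tel m l p := (tele (mxrows N0 m) l p).
Implicit Types (l : seq (slot R)) (m p : nat).

Lemma tele_ext m s l p (f g : tel m (s :: l) p) :
  (forall X Z, f X Z = g X Z) -> f = g.
Proof.
by move=> fg; apply: functional_extensionality_dep => X; apply/funext => Z.
Qed.

Lemma tele_appD m s l p (f g : tel m (s :: l) p) X Z :
  (f + g : tel m (s :: l) p) X Z = (f X Z : tel m l (psize X)) + g X Z.
Proof. by []. Qed.

Lemma tele_appZ m s l p a (f : tel m (s :: l) p) X Z :
  (a *: f : tel m (s :: l) p) X Z = a *: (f X Z : tel m l (psize X)).
Proof. by []. Qed.

Lemma tele_app_sum m s l p I (r : seq I) (P : pred I)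
    (f : I -> tel m (s :: l) p) X Z :
  (\sum_(i <- r | P i) f i : tel m (s :: l) p) X Z =
  \sum_(i <- r | P i) (f i X Z : tel m l (psize X)).
Proof. exact: (big_morph (fun g : tel m (s :: l) p => g X Z)). Qed.

Lemma lmulD m m' (T : 'M[C]_(m', m)) l p (f g : tel m l p) :
  tele_lmul T (f + g) = tele_lmul T f + tele_lmul T g.
Proof.
elim: l p f g => [|s l IH] p f g; first exact: lmulmxVDr.
by apply: tele_ext => X Z; exact: IH.
Qed.

Lemma lmulZ m m' (T : 'M[C]_(m', m)) l p a (f : tel m l p) :
  tele_lmul T (a *: f) = a *: tele_lmul T f.
Proof.
elim: l p f => [|s l IH] p f; first exact: lmulmxVZr.
by apply: tele_ext => X Z; exact: IH.
Qed.

Lemma lmulDl m m' (S T : 'M[C]_(m', m)) l p (f : tel m l p) :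
  tele_lmul (S + T) f = tele_lmul S f + tele_lmul T f.
Proof.
elim: l p f => [|s l IH] p f; first exact: lmulmxVDl.
by apply: tele_ext => X Z; exact: IH.
Qed.

Lemma lmulZl m m' (T : 'M[C]_(m', m)) l p a (f : tel m l p) :
  tele_lmul (a *: T) f = a *: tele_lmul T f.
Proof.
elim: l p f => [|s l IH] p f; first exact: lmulmxVZl.
by apply: tele_ext => X Z; exact: IH.
Qed.

Lemma lmulA m m' m'' (S : 'M[C]_(m'', m')) (T : 'M[C]_(m', m)) l p
    (f : tel m l p) :
  tele_lmul S (tele_lmul T f) = tele_lmul (S *m T) f.
Proof.
elim: l p f => [|s l IH] p f; first exact: lmulmxVA.
by apply: tele_ext => X Z; exact: IH.
Qed.

Lemma lmul1 m l p (f : tel m l p) : tele_lmul 1%:M f = f.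
Proof.
elim: l p f => [|s l IH] p f; first exact: lmul1mxV.
by apply: tele_ext => X Z; exact: IH.
Qed.

Lemma lmul_app m m' (T : 'M[C]_(m', m)) s l p (f : tel m (s :: l) p) X Z :
  tele_lmul T f X Z = tele_lmul T (f X Z).
Proof. by []. Qed.

Lemma lmul0 m m' (T : 'M[C]_(m', m)) l p :
  tele_lmul T (0 : tel m l p) = 0.
Proof. by rewrite -(scale0r 0) lmulZ !scale0r. Qed.

Lemma lmul_sum m m' (T : 'M[C]_(m', m)) l p I (r : seq I) (P : pred I)
    (f : I -> tel m l p) :
  tele_lmul T (\sum_(i <- r | P i) f i) =
  \sum_(i <- r | P i) tele_lmul T (f i).
Proof.
exact: (big_morph (@tele_lmul R N0 m m' T l p) (lmulD T (p:=p)) (lmul0 T l p)).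
Qed.

Lemma absorbD m p p' (T : 'M[C]_(p', p)) l (f g : tel m l p') :
  tele_absorb T (f + g) = tele_absorb T f + tele_absorb T g.
Proof. by case: l f g => [|s l] f g //; exact: rmulmxVDl. Qed.

Lemma absorbZ m p p' (T : 'M[C]_(p', p)) l a (f : tel m l p') :
  tele_absorb T (a *: f) = a *: tele_absorb T f.
Proof. by case: l f => [|s l] f //; exact: rmulmxVZl. Qed.

Lemma absorb_0r m p p' (T : 'M[C]_(p', p)) l :
  tele_absorb T (0 : tel m l p') = 0.
Proof. by rewrite -(scale0r 0) absorbZ !scale0r. Qed.

Lemma absorbA m p p' p'' (S : 'M[C]_(p', p)) (T : 'M[C]_(p'', p')) l
    (f : tel m l p'') :
  tele_absorb S (tele_absorb T f) = tele_absorb (T *m S) f.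
Proof.
case: l f => [|s l] f; first exact: rmulmxVA.
by apply: tele_ext => X Z /=; rewrite lmulmxVA.
Qed.

Lemma absorb1 m p l (f : tel m l p) : tele_absorb 1%:M f = f.
Proof.
case: l f => [|s l] f; first exact: rmulmxV1.
by apply: tele_ext => X Z /=; rewrite lmul1mxV.
Qed.

Lemma lmul_absorb m m' (S : 'M[C]_(m', m)) p p' (T : 'M[C]_(p', p)) l
    (f : tel m l p') :
  tele_lmul S (tele_absorb T f) = tele_absorb T (tele_lmul S f).
Proof. by case: l f => [|s l] f //; rewrite /tele_lmul /= lrmulmxVA. Qed.

Lemma multilinear_appD m s l p (f : tel m (s :: l) p) X Z Z' :
  multilinear f -> f X (Z + Z') = (f X Z : tel m l (psize X)) + f X Z'.
Proof. by move=> mf; case: (mf X). Qed.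

Lemma multilinear_appZ m s l p (f : tel m (s :: l) p) X a Z :
  multilinear f -> f X (scalemxV a Z) = a *: (f X Z : tel m l (psize X)).
Proof. by move=> mf; case: (mf X). Qed.

Lemma multilinear_app m s l p (f : tel m (s :: l) p) X Z :
  multilinear f -> multilinear (f X Z).
Proof. by move=> mf; case: (mf X) => _ _; exact. Qed.

Lemma multilinear_app0 m s l p (f : tel m (s :: l) p) X :
  multilinear f -> f X 0 = 0 :> tel m l (psize X).
Proof.
by move=> mf; rewrite -(scalemxV0 _ _ _ 0) multilinear_appZ // scale0r.
Qed.

Lemma multilinearD m l p (f g : tel m l p) :
  multilinear f -> multilinear g -> multilinear (f + g).
Proof.
elim: l p f g => [|s l IH] p f g // mf mg X; split=> [Z Z'|a Z|Z].
- change ((f + g : tel m (s :: l) p) X (Z + Z') =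
    ((f + g : tel m (s :: l) p) X Z : tel m l (psize X))
      + (f + g : tel m (s :: l) p) X Z').
  by rewrite !tele_appD !multilinear_appD // addrACA.
- change ((f + g : tel m (s :: l) p) X (scalemxV a Z) =
    a *: ((f + g : tel m (s :: l) p) X Z : tel m l (psize X))).
  by rewrite !tele_appD !multilinear_appZ // scalerDr.
- by apply: IH; exact: multilinear_app.
Qed.

Lemma multilinearZ m l p a (f : tel m l p) :
  multilinear f -> multilinear (a *: f).
Proof.
elim: l p f => [|s l IH] p f // mf X; split=> [Z Z'|b Z|Z].
- change ((a *: f : tel m (s :: l) p) X (Z + Z') =
    ((a *: f : tel m (s :: l) p) X Z : tel m l (psize X))
      + (a *: f : tel m (s :: l) p) X Z').
  by rewrite !tele_appZ multilinear_appD // scalerDr.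
- change ((a *: f : tel m (s :: l) p) X (scalemxV b Z) =
    b *: ((a *: f : tel m (s :: l) p) X Z : tel m l (psize X))).
  by rewrite !tele_appZ multilinear_appZ // !scalerA mulrC.
- by apply: IH; exact: multilinear_app.
Qed.

Lemma multilinear0 m l p : multilinear (0 : tel m l p).
Proof.
elim: l p => [|s l IH] p // X; split=> [Z Z'|a Z|Z]; last exact: IH.
- exact: (esym (addr0 (0 : tel m l (psize X)))).
- exact: (esym (scaler0 (tel m l (psize X)) a)).
Qed.

Lemma multilinear_sum m l p I (r : seq I) (P : pred I) (f : I -> tel m l p) :
  (forall i, P i -> multilinear (f i)) ->
  multilinear (\sum_(i <- r | P i) f i).
Proof.
move=> mf; elim/big_ind: _ => // [|g h]; first exact: multilinear0.
exact: multilinearD.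
Qed.

Lemma multilinear_absorb m p p' (T : 'M[C]_(p', p)) l (f : tel m l p') :
  multilinear f -> multilinear (tele_absorb T f).
Proof.
case: l f => [|s l] f //= mf X; split=> [Z Z'|a Z|Z]; last by case: (mf X).
- by rewrite lmulmxVDr; case: (mf X).
- by rewrite lmulmxVZr; case: (mf X).
Qed.

Lemma multilinear_lmul m m' (T : 'M[C]_(m', m)) l p (f : tel m l p) :
  multilinear f -> multilinear (tele_lmul T f).
Proof.
elim: l p f => [|s l IH] p f // mf X; split=> [Z Z'|a Z|Z].
- by rewrite !lmul_app multilinear_appD // lmulD.
- by rewrite !lmul_app multilinear_appZ // lmulZ.
- exact/IH/multilinear_app.
Qed.

(** When a matrix argument is left, [T] enters [f] through that argument, so additivity in [T] is
    linearity of [f] in it. *)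
Lemma absorbDl m p p' (S T : 'M[C]_(p', p)) l (f : tel m l p') :
  multilinear f ->
  tele_absorb (S + T) f = tele_absorb S f + tele_absorb T f.
Proof.
case: l f => [|s l] f mf; first exact: rmulmxVDr.
by apply: tele_ext => X Z /=; rewrite lmulmxVDl multilinear_appD.
Qed.

Lemma absorbZl m p p' (T : 'M[C]_(p', p)) l a (f : tel m l p') :
  multilinear f -> tele_absorb (a *: T) f = a *: tele_absorb T f.
Proof.
case: l f => [|s l] f mf; first exact: rmulmxVZr.
by apply: tele_ext => X Z /=; rewrite lmulmxVZl multilinear_appZ.
Qed.

Lemma absorb0 m p p' l (f : tel m l p') :
  multilinear f -> tele_absorb (0 : 'M[C]_(p', p)) f = 0.
Proof. by move=> mf; rewrite -(scale0r 0) absorbZl // scale0r. Qed.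

Lemma absorb_sum m p p' (T : 'M[C]_(p', p)) l I (r : seq I) (P : pred I)
    (f : I -> tel m l p') :
  tele_absorb T (\sum_(i <- r | P i) f i) =
  \sum_(i <- r | P i) tele_absorb T (f i).
Proof.
apply: (big_morph (@tele_absorb R N0 m p p' T l)); last exact: absorb_0r.
exact: absorbD.
Qed.

Lemma multilinear_app_sum m s l p (f : tel m (s :: l) p) X
    I (r : seq I) (P : pred I) (Z : I -> 'M[sN s]_(p, psize X)) :
  multilinear f ->
  f X (\sum_(i <- r | P i) Z i) =
  \sum_(i <- r | P i) (f X (Z i) : tel m l (psize X)).
Proof.
move=> mf; apply: (big_morph (f X)); last exact: multilinear_app0.
by move=> A B; exact: multilinear_appD.
Qed.

End TeleTheory.

(** * Difference formulas *)

Section Differences.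
Variables (R : realType) (N0 : lmodType R[i]).
Local Notation C := R[i].
Local Notation tel m l p := (tele (mxrows N0 m) l p).
Implicit Types (l : seq (slot R)) (m p j : nat).

(* T need not intertwine X and X': for intertwining T the correction vanishes,
   and for T = [1 0] from a block matrix one recovers Delta. *)
Fixpoint diff m j l p {struct l} :
    tel m l p -> tel m (dup_right j l) p -> Prop :=
  match l return tel m l p -> tel m (dup_right j l) p -> Prop with
  | [::] => fun _ _ => True
  | s :: l' =>
      match j return tel m (s :: l') p -> tel m (dup_right j (s :: l')) p ->
          Prop with
      | 0%N => fun f G =>
          forall (X X' : ncpoint (sOm s)) (T : 'M[C]_(psize X', psize X)) Z,
            f X (rmulmxV Z T) = tele_absorb T (f X' Z) +
              (G X' Z X (lmulmxV T X - rmulmxV X' T) : tel m l' (psize X))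
      | j'.+1 => fun f G => forall X Z, diff (j := j') (f X Z) (G X Z)
      end
  end.

Lemma diff0 m j l p : diff (j := j) (0 : tel m l p) 0.
Proof.
elim: l j p => [|s l IH] [|j] p //.
move=> X X' T Z.
rewrite -[RHS]/(tele_absorb T (0 : tel m l (psize X')) + 0).
by rewrite absorb_0r addr0.
Qed.

Lemma diffD m j l p (f g : tel m l p) F G :
  diff (j := j) f F -> diff (j := j) g G -> diff (j := j) (f + g) (F + G).
Proof.
elim: l j p f g F G => [|s l IH] [|j] p f g F G //= hf hg; last first.
  by move=> X Z; exact: IH.
move=> X X' T Z.
rewrite -[LHS]/((f X (rmulmxV Z T) : tel m l _) + g X (rmulmxV Z T)) hf hg.
by rewrite addrACA -absorbD.
Qed.

Lemma diffZ m j l p a (f : tel m l p) F :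
  diff (j := j) f F -> diff (j := j) (a *: f) (a *: F).
Proof.
elim: l j p f F => [|s l IH] [|j] p f F //= hf; last first.
  by move=> X Z; exact: IH.
move=> X X' T Z.
rewrite -[LHS]/(a *: (f X (rmulmxV Z T) : tel m l _)) hf.
by rewrite scalerDr -absorbZ.
Qed.

Lemma diff_sum m j l p I (r : seq I) (P : pred I) (f : I -> tel m l p)
    (G : I -> tel m (dup_right j l) p) :
  (forall i, P i -> diff (f i) (G i)) ->
  diff (\sum_(i <- r | P i) f i) (\sum_(i <- r | P i) G i).
Proof.
move=> hfG; elim/big_ind2: _ => //; first exact: diff0.
by move=> *; exact: diffD.
Qed.

Lemma diff_absorb m j l p p' (T : 'M[C]_(p', p)) (f : tel m l p') G :
  diff (j := j) f G -> diff (j := j) (tele_absorb T f) (tele_absorb T G).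
Proof.
case: l j f G => [|s l] [|j] f G //= hf.
move=> X X' S Z.
by rewrite -lrmulmxVA hf.
Qed.

(** Names the scalar and the block point hidden in [at_block], so that proofs can work with an
    arbitrary admissible [r]. *)
Lemma Delta_right0E m s l p (f : tel m (s :: l) p)
    (X1 : ncpoint (sOm s)) Z1 (X2 : ncpoint (sOm s)) Z :
  exists2 r : C, r != 0 &
    exists hP : sOm s _ (block_mx X1 (scalemxV r Z) 0 X2),
    Delta_right 0 f X1 Z1 X2 Z = r^-1 *: (tele_absorb
      (inj_low R (psize X1) (psize X2)) (f (NcPoint hP) (row_mx Z1 0))
      : tel m l (psize X2)).
Proof.
rewrite /= /at_block; set q := cid _.
by exists (sval q); [exact: (svalP q).1 | exists (svalP q).2].
Qed.

Lemma respects_right_app m s l p (f : tel m (s :: l) p)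
    (X X' : ncpoint (sOm s)) (T : 'M[C]_(psize X', psize X)) Z :
  respects_right f -> lmulmxV T X = rmulmxV X' T ->
  f X (rmulmxV Z T) = tele_absorb T (f X' Z).
Proof. by case=> + _ => /(_ X X' T)/[apply]. Qed.

Lemma respects_right0 m l p : respects_right (0 : tel m l p).
Proof.
elim: l p => [|s l IH] p //; split=> [X X' T _ Z|X Z]; last exact: IH.
by rewrite -[RHS]/(tele_absorb T (0 : tel m l (psize X'))) absorb_0r.
Qed.

Lemma block_inj_up (V : lmodType C) n1 n2 (X1 : 'M[V]_n1) (X2 : 'M[V]_n2) Y :
  lmulmxV (col_mx 1%:M 0) X1 = rmulmxV (block_mx X1 Y 0 X2) (col_mx 1%:M 0).
Proof.
rewrite lmul_col_mxV lmul1mxV lmul0mxV block_mxEv rmul_col_mxV.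
by rewrite !rmul_row_colV rmulmxV1 !rmulmxV0 rmul0mxV !addr0.
Qed.

Lemma block_proj_low (V : lmodType C) n1 n2 (X1 : 'M[V]_n1) (X2 : 'M[V]_n2) Y :
  lmulmxV (row_mx 0 1%:M) (block_mx X1 Y 0 X2) = rmulmxV X2 (row_mx 0 1%:M).
Proof.
rewrite block_mxEv lmul_row_colV lmul0mxV lmul1mxV add0r.
by rewrite rmul_mxV_row rmulmxV0 rmulmxV1.
Qed.

(** The projection [1 0] fails to intertwine the block matrix with [X1] by exactly the corner [Y],
    followed by the projection [0 1]. This makes [Delta] an instance of the difference formula. *)
Lemma block_proj_up (V : lmodType C) n1 n2 (X1 : 'M[V]_n1) (X2 : 'M[V]_n2) Y :
  lmulmxV (proj_up R n1 n2) (block_mx X1 Y 0 X2)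
    - rmulmxV X1 (proj_up R n1 n2) = rmulmxV Y (row_mx 0 1%:M).
Proof.
rewrite /proj_up block_mxEv lmul_row_colV lmul0mxV lmul1mxV addr0.
rewrite !rmul_mxV_row !rmulmxV0 !rmulmxV1 opp_row_mx add_row_mx.
by rewrite subrr oppr0 addr0.
Qed.

(** Let P be the block matrix with diagonal X', X and corner r A, where A = T X - X' T. The columns
    [r T; 1] and [1; 0] intertwine X and X' with P, and [r T; 1] = r [1; 0] T + [0; 1]. The first
    summand yields r times the term of X', the second r times the difference. *)
Lemma diff_Delta m j l p (f : tel m l p) :
  multilinear f -> respects_right f -> diff f (Delta_right j f).
Proof.
elim: l j p f => [|s l IH] [|j] p f mf rf //; last first.
  move=> X Z; apply: IH; first exact: multilinear_app.
  exact: (proj2 rf).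
move=> X X' T Z; set A := _ - _.
have [r r0 [hP ->]] := Delta_right0E f Z (A : 'M_(psize X', psize X)).
set P := NcPoint hP; have [rf0 _] := rf.
have PE : pval P = block_mx X' (scalemxV r A) 0 X by [].
have fX : tele_absorb (col_mx (r *: T) 1%:M) (f P (row_mx Z 0))
    = r *: (f X (rmulmxV Z T) : tel m l _).
  rewrite -(rf0 X P (col_mx (r *: T) 1%:M)); last first.
    rewrite /intertwines PE lmul_col_mxV lmul1mxV block_mxEv rmul_col_mxV.
    rewrite !rmul_row_colV !rmulmxV1 rmul0mxV add0r; congr col_mx.
    rewrite lmulmxVZl rmulmxVZr -scalemxVDr; congr scalemxV.
    by rewrite /A addrC subrK.
  by rewrite rmul_row_colV rmul0mxV addr0 rmulmxVZr multilinear_appZ.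
have fX' : f X' Z = tele_absorb (col_mx 1%:M 0) (f P (row_mx Z 0)).
  rewrite -(rf0 X' P (col_mx 1%:M 0)); last exact: block_inj_up.
  by rewrite rmul_row_colV rmulmxV1 rmulmxV0 addr0.
apply: (@scalerI _ (tel m l (psize X)) r r0).
rewrite -fX scalerDr scalerA divff // scale1r fX' absorbA.
have mfP : multilinear (f P (row_mx Z 0)) by exact: multilinear_app.
rewrite -(absorbZl _ r mfP) -absorbDl //.
by rewrite mul_col_mx mul1mx mul0mx scale_col_mx scaler0 add_col_mx addr0 add0r.
Qed.

(** In the formula from P to X1 take T = [1 0]. Absorbing [0; 1] kills the term f(X1), since [1 0]
    [0; 1] = 0. As [0 1] intertwines P with X2, the correction becomes r G(X1, X2)(Z). The bound on
    [j] matters: beyond the list [diff] says nothing. *)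
Lemma diff_unique m j l p (f : tel m l p) (G : tel m (dup_right j l) p) :
  (j < size l)%N -> multilinear f -> multilinear G -> respects_right G ->
  diff f G -> Delta_right j f = G.
Proof.
elim: l j p f G => [|s l IH] [|j] p f G //= jl mf mG rG hf; last first.
  apply: tele_ext => X Z; apply: IH => //; first exact: multilinear_app.
  - exact: (multilinear_app (l := dup_right j l)).
  - exact: (proj2 rG X Z).
apply: (tele_ext (s := s) (l := Slot (sV s) (sOm s) :: l)) => X1 Z1.
apply: (tele_ext (s := Slot (sV s) (sOm s))) => X2 Z.
have [r r0 [hP fE]] := Delta_right0E f Z1 Z; apply: (etrans fE).
set P := NcPoint hP.
have -> : row_mx Z1 0 = rmulmxV Z1 (proj_up R (psize X1) (psize X2)).
  by rewrite /proj_up rmul_mxV_row rmulmxV1 rmulmxV0.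
rewrite (hf P X1) absorbD absorbA [X in tele_absorb X _](_ : _ = 0); last first.
  by rewrite /proj_up /inj_low mul_row_col mul1mx mul0mx addr0.
rewrite absorb0 ?add0r; last exact: multilinear_app.
rewrite block_proj_up rmulmxVZl.
rewrite (multilinear_appZ (s := Slot (sV s) (sOm s))); last first.
  exact: (multilinear_app (l := Slot (sV s) (sOm s) :: l)).
rewrite absorbZ scalerA mulVf // scale1r.
rewrite (respects_right_app (s := Slot (sV s) (sOm s)) (X := P) (X' := X2)).
- rewrite absorbA /inj_low mul_row_col mul0mx mul1mx add0r; exact: absorb1.
- exact: (proj2 rG X1 Z1).
- exact: block_proj_low.
Qed.

(** For an intertwining [T] the correction is [G] at the argument 0, which vanishes by linearity. *)
Lemma respects_right_diff m l p (f : tel m l p)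
    (G : forall j, tel m (dup_right j l) p) :
  (forall j, (j < size l)%N -> multilinear (G j)) ->
  (forall j, (j < size l)%N -> diff f (G j)) -> respects_right f.
Proof.
elim: l p f G => [|s l IH] p f G //= mG hf; split.
  move=> X X' T TX Z; rewrite (hf 0%N) // TX subrr.
  rewrite (multilinear_app0 (s := Slot (sV s) (sOm s))) ?addr0 //.
  by apply: (multilinear_app (s := s) (l := Slot (sV s) (sOm s) :: l));
    exact: (mG 0%N).
move=> X Z; apply: (IH _ _ (fun j => G j.+1 X Z)) => j jl.
  by apply: (multilinear_app (s := s) (l := dup_right j l)); exact: (mG j.+1).
by have := hf j.+1 jl; apply.
Qed.

End Differences.

(** * Commutation of second differences in one slot *)

Section Commutation.
Variables (R : realType) (N0 : lmodType R[i]).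
Local Notation C := R[i].
Local Notation tel m l p := (tele (mxrows N0 m) l p).
Local Notation vslot s := (Slot (sV s) (sOm s)).
Implicit Types (l : seq (slot R)) (m p i j : nat).

(** The scalar chosen in [at_block] depends only on the points and on [Z], not on the function, so
    both sides are evaluated at the same block point. *)
Lemma Delta_rightZ m j l p a (f : tel m l p) :
  Delta_right j (a *: f) = a *: Delta_right j f.
Proof.
elim: l j p f => [|s l IH] [|j] p f //; last first.
  by apply: (tele_ext (s := s)) => X Z; exact: IH.
apply: (tele_ext (s := s) (l := vslot s :: l)) => X1 Z1.
apply: (tele_ext (s := vslot s)) => X2 Z.
rewrite [LHS]/= /at_block; set q := cid _.
rewrite -[LHS]/((sval q)^-1 *: (tele_absorb _
  (a *: (f (NcPoint (svalP q).2) (row_mx Z1 0) : tel m l _)))).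
by rewrite absorbZ scalerA mulrC -scalerA.
Qed.

Lemma Delta_right_absorb m p p' (T : 'M[C]_(p', p)) j l (f : tel m l p') :
  Delta_right j (tele_absorb T f) = tele_absorb T (Delta_right j f).
Proof.
case: l j f => [|s l] [|j] f //.
apply: (tele_ext (s := s) (l := vslot s :: l)) => X1 Z1.
apply: (tele_ext (s := vslot s)) => X2 Z /=.
by rewrite lmul_mxV_row lmulmxV0.
Qed.

Lemma Delta_right_lmul m m' (T : 'M[C]_(m', m)) j l p (f : tel m l p) :
  Delta_right j (tele_lmul T f) = tele_lmul T (Delta_right j f).
Proof.
elim: l j p f => [|s l IH] [|j] p f //; last first.
  by apply: (tele_ext (s := s)) => X Z; exact: IH.
apply: (tele_ext (s := s) (l := vslot s :: l)) => X1 Z1.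
apply: (tele_ext (s := vslot s)) => X2 Z.
rewrite [LHS]/= /at_block; set q := cid _.
rewrite -[LHS]/((sval q)^-1 *: (tele_absorb _
  (tele_lmul T (f (NcPoint (svalP q).2) (row_mx Z1 0) : tel m l _)))).
by rewrite -lmul_absorb -lmulZ.
Qed.

(** The value f(X)(z U T) is computed in two ways, from Y directly along U T and from Y through X'.
    The common term in f(Y)(z) cancels. *)
Lemma diff_cocycle m s l p (f : tel m (s :: l) p)
    (h : tel m (s :: vslot s :: l) p) (Y X' X : ncpoint (sOm s))
    (U : 'M[C]_(psize Y, psize X')) (T : 'M[C]_(psize X', psize X)) z :
  diff (j := 0) f h ->
  h Y z X (lmulmxV (U *m T) X - rmulmxV Y (U *m T)) =
  tele_absorb T (h Y z X' (lmulmxV U X' - rmulmxV Y U))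
  + (h X' (rmulmxV z U) X (lmulmxV T X - rmulmxV X' T) : tel m l (psize X)).
Proof.
move=> fh; apply: (@addrI (tel m l _) (tele_absorb (U *m T) (f Y z))).
by rewrite -fh -rmulmxVA (fh X X') (fh X' Y) absorbD absorbA addrA.
Qed.

(* The cocycle identity for X1 <- P12 <- P23, with U = [1 0] and
   T = [0 0; 1 0], for which U T = 0: this compares the two second-order
   differences at arbitrary Z2 and Z3. *)
Lemma Delta_right_comm00 m s l p (f : tel m (s :: l) p)
    (h : tel m (s :: vslot s :: l) p) :
  diff (j := 0) f h -> multilinear h -> respects_right h ->
  Delta_right 0 h = Delta_right 1 h :> tel m [:: s, vslot s, vslot s & l] p.
Proof.
move=> fh mh rh.
apply: (tele_ext (s := s) (l := [:: vslot s, vslot s & l])) => X1 z.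
apply: (tele_ext (s := vslot s) (l := vslot s :: l)) => X2 Z2.
apply: (tele_ext (s := vslot s) (l := l)) => X3 Z3.
have [r r0 [hP12 E0]] := Delta_right0E h z Z2.
have [r' r'0 [hP23 E1]] := Delta_right0E (h X1 z) Z2 Z3.
transitivity (r^-1 *: (h (NcPoint hP12) (row_mx z 0) X3
    (lmulmxV (inj_low R (psize X1) (psize X2)) Z3) : tel m l _)).
  by rewrite E0.
rewrite -[RHS]/(Delta_right 0 (h X1 z : tel m (vslot s :: l) _) X2 Z2 X3 Z3) E1.
set P12 := NcPoint hP12 : ncpoint (sOm s).
set P23 := NcPoint hP23 : ncpoint (sOm s).
(* [T] projects [P23] onto its [X2] block and then embeds this as the lower block of [P12]. *)
pose U := proj_up R (psize X1) (psize X2) : 'M_(psize X1, psize P12).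
pose u := proj_up R (psize X2) (psize X3) : 'M_(psize X2, psize P23).
pose T := inj_low R (psize X1) (psize X2) *m u : 'M_(psize P12, psize P23).
pose q := row_mx 0 1%:M : 'M[C]_(psize X3, psize P23).
have qP23 : lmulmxV u P23 - rmulmxV X2 u = rmulmxV (scalemxV r' Z3) q.
  exact: block_proj_up.
have P12i : rmulmxV P12 (inj_low R (psize X1) (psize X2)) =
    lmulmxV (col_mx 1%:M 0) (scalemxV r Z2) + lmulmxV (inj_low R _ _) X2.
  rewrite -[pval P12]/(block_mx X1 (scalemxV r Z2) 0 X2) block_mxEv.
  rewrite rmul_col_mxV !rmul_row_colV !rmulmxV0 !rmulmxV1 !add0r.
  by rewrite !lmul_col_mxV !lmul0mxV !lmul1mxV add_col_mx addr0 add0r.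
(* The defect of [T] has one term from the corner of [P23] and one from the corner of [P12]; each
   leads to one of the two second differences. *)
have TP : lmulmxV T P23 - rmulmxV P12 T =
    scalemxV r' (lmulmxV (inj_low R _ _) (rmulmxV Z3 q))
    + scalemxV (- r) (lmulmxV (col_mx 1%:M 0) (rmulmxV Z2 u)).
  rewrite /T -lmulmxVA -rmulmxVA P12i rmulmxVDl !lrmulmxVA.
  rewrite opprD addrCA -[- lmulmxV (inj_low _ _ _) _]lmulmxVN -lmulmxVDr.
  by rewrite qP23 addrC !rmulmxVZl !lmulmxVZr scaleNmxV.
have UT : U *m T = 0.
  by rewrite mulmxA /U /proj_up /inj_low mul_row_col mul1mx mulmx1 add0r mul0mx.
have zU : rmulmxV z U = row_mx z 0.
  by rewrite /U /proj_up rmul_mxV_row rmulmxV1 rmulmxV0.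
have Zu : rmulmxV Z2 u = row_mx Z2 0.
  by rewrite /u /proj_up rmul_mxV_row rmulmxV1 rmulmxV0.
have mhz Y w : multilinear (h Y w : tel m (vslot s :: l) _).
  exact: multilinear_app.
have mhz' Y w X A : multilinear (h Y w X A : tel m l _).
  exact: (multilinear_app (s := vslot s)).
have F1 : h X1 z P12 (lmulmxV U P12 - rmulmxV X1 U) =
    r *: (tele_absorb (row_mx 0 1%:M) (h X1 z X2 Z2) : tel m l _).
  rewrite block_proj_up rmulmxVZl (multilinear_appZ (s := vslot s)) //.
  apply: (congr1 (fun g : tel m l (psize P12) => r *: g)).
  apply: (respects_right_app (s := vslot s)).
    exact: (proj2 rh X1 z).
  exact: block_proj_low.
have F2 : h P12 (row_mx z 0) P23
      (lmulmxV (inj_low R _ _) (rmulmxV Z3 q)) =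
    tele_absorb q (h P12 (row_mx z 0) X3 (lmulmxV (inj_low R _ _) Z3)).
  rewrite -lrmulmxVA; apply: (respects_right_app (s := vslot s)).
    exact: (proj2 rh P12 (row_mx z 0)).
  exact: block_proj_low.
(* Since [1; 0] embeds [X1] in [P12] and z = [z 0] [1; 0], the first point of [h] moves from [P12]
   to [X1]. *)
have F3 : h P12 (row_mx z 0) P23 (lmulmxV (col_mx 1%:M 0) (rmulmxV Z2 u)) =
    h X1 z P23 (rmulmxV Z2 u).
  have -> : z = rmulmxV (row_mx z 0) (col_mx 1%:M 0 : 'M_(psize P12, _)).
    by rewrite rmul_row_colV rmulmxV0 rmulmxV1 addr0.
  rewrite [in RHS](respects_right_app (X' := P12) _ rh); last first.
    exact: block_inj_up.
  by rewrite rmul_row_colV rmulmxV0 rmulmxV1 addr0.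
have := diff_cocycle U T z fh.
rewrite F1 zU TP UT lmul0mxV rmulmxV0 subrr.
rewrite (multilinear_app0 (s := vslot s)) //.
rewrite (multilinear_appD (s := vslot s)) //.
rewrite !(multilinear_appZ (s := vslot s)) //.
rewrite F2 F3 Zu absorbZ absorbA.
have -> : row_mx 0 1%:M *m T = u.
  by rewrite mulmxA /inj_low mul_row_col mul0mx mulmx1 add0r mul1mx.
(* Absorbing [0; 1] restricts to the last block of [P23]: [u] becomes 0 and [q] becomes 1, which
   leaves just the two second differences. *)
move/(congr1 (fun g : tel m l (psize X2 + psize X3) =>
  tele_absorb (inj_low R (psize X2) (psize X3)) g)).
rewrite absorb_0r !absorbD !absorbZ !absorbA.
rewrite [u *m _](_ : _ = 0); last first.
  by rewrite /u /proj_up /inj_low mul_row_col mul1mx mul0mx addr0.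
rewrite [q *m _](_ : _ = 1%:M); last first.
  by rewrite /q /inj_low mul_row_col mul0mx mul1mx add0r.
rewrite absorb0 // scaler0 add0r absorb1 scaleNr => /esym/subr0_eq H.
apply: (@scalerI _ (tel m l _) (r * r')); first by rewrite mulf_neq0.
by rewrite scalerA mulrAC divff // mul1r H scalerA -mulrA divff // mulr1.
Qed.

End Commutation.

(** * Antiderivatives *)

Section Antiderivative.
Variables (R : realType) (N0 : lmodType R[i]).
Local Notation C := R[i].
Local Notation tel m l p := (tele (mxrows N0 m) l p).
Local Notation vslot s := (Slot (sV s) (sOm s)).
Implicit Types (l : seq (slot R)) (m p i j : nat).

Lemma rmulmxV_delta_sum (V : lmodType C) p n n' (i0 : 'I_n')
    (Z : 'M[V]_(p, n)) :
  Z = \sum_a rmulmxV (rmulmxV Z (delta_mx a i0)) (delta_mx i0 a).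
Proof.
rewrite -{1}[Z]rmulmxV1 mx1_sum_delta rmulmxV_sum.
by apply: eq_bigr => a _; rewrite rmulmxVA mul_delta_mx.
Qed.

(** A bilinear [phi] is contracted over an inner index, and [T] passes from one factor to the other.
    With E the matrix units, both sides expand to the sum over a and b of T b a times phi of Z E(b,
    i0) and E(i0, a). *)
Lemma delta_contraction (V E : lmodType C) p q n n' (i0 : 'I_q)
    (phi : 'M[V]_(p, q) -> 'M[C]_(q, n) -> E)
    (Z : 'M[V]_(p, n')) (T : 'M[C]_(n', n)) :
  (forall z z' S, phi (z + z') S = phi z S + phi z' S) ->
  (forall a z S, phi (scalemxV a z) S = a *: phi z S) ->
  (forall z S S', phi z (S + S') = phi z S + phi z S') ->
  (forall a z S, phi z (a *: S) = a *: phi z S) ->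
  \sum_a phi (rmulmxV (rmulmxV Z T) (delta_mx a i0)) (delta_mx i0 a) =
  \sum_b phi (rmulmxV Z (delta_mx b i0)) (delta_mx i0 b *m T).
Proof.
move=> phiDl phiZl phiDr phiZr.
have phi0l S : phi 0 S = 0 by rewrite -(scalemxV0 _ _ _ 0) phiZl scale0r.
have phi0r z : phi z 0 = 0 by rewrite -(scale0r 0) phiZr scale0r.
transitivity (\sum_a \sum_b
    T b a *: phi (rmulmxV Z (delta_mx b i0)) (delta_mx i0 a)).
  apply: eq_bigr => a _; rewrite rmulmxVA.
  have -> : T *m delta_mx a i0 = \sum_b T b a *: delta_mx b i0.
    rewrite {1}[T]matrix_sum_delta mulmx_suml; apply: eq_bigr => b _.
    rewrite mulmx_suml (bigD1 a) //= -scalemxAl mul_delta_mx.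
    rewrite big1 ?addr0 // => c ca.
    by rewrite -scalemxAl mul_delta_mx_0 ?scaler0.
  rewrite rmulmxV_sum.
  rewrite (big_morph (phi^~ _) (fun z z' => phiDl z z' _) (phi0l _)).
  by apply: eq_bigr => b _; rewrite rmulmxVZr phiZl.
rewrite exchange_big; apply: eq_bigr => b _ /=.
have -> : delta_mx i0 b *m T = \sum_a T b a *: delta_mx i0 a.
  rewrite {1}[T]matrix_sum_delta mulmx_sumr (bigD1 b) //= addrC.
  rewrite big1 ?add0r.
    rewrite mulmx_sumr; apply: eq_bigr => a _.
    by rewrite -scalemxAr mul_delta_mx.
  move=> c cb; rewrite mulmx_sumr big1 // => a _.
  by rewrite -scalemxAr mul_delta_mx_0 ?scaler0 // eq_sym.
rewrite (big_morph (phi _) (phiDr _) (phi0r _)).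
by apply: eq_bigr => a _; rewrite phiZr.
Qed.

(** The choice sees only the proposition [inhabited T]. Its proofs are all equal, so
    [choice_of (inhabits X)] is the same element for every [X]. *)
Definition choice_of (T : Type) (h : inhabited T) : T :=
  sval (cid (let: inhabits x := h in ex_intro (fun=> True) x I)).

Definition corner (V : lmodType C) (Om : ncdom V) (Y : ncpoint Om) :
    'I_(psize Y) :=
  Ordinal (ncdom_gt0 (pval_in Y)).

(* The difference formula, applied to the decomposition of the identity matrix
   as the sum over a of delta_mx a (corner Y) *m delta_mx (corner Y) a,
   expresses f at X through f at Y.  The base point Y exists as soon as X does,
   and does not depend on X. *)
Fixpoint antider m l p :
    (forall j, tel m (dup_right j l) p) -> tel m l p :=
  match l return (forall j, tel m (dup_right j l) p) -> tel m l p with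
  | [::] => fun=> 0
  | s :: l' => fun G X Z =>
      let Y := choice_of (inhabits X) in
      \sum_(a < psize X)
        (tele_absorb (delta_mx (corner Y) a)
           (antider (fun j => G j.+1 Y (rmulmxV Z (delta_mx a (corner Y)))))
         + (G 0%N Y (rmulmxV Z (delta_mx a (corner Y))) X
              (lmulmxV (delta_mx (corner Y) a) X
               - rmulmxV Y (delta_mx (corner Y) a)) : tel m l' (psize X)))
  end.

Lemma antider_ext m l p (G H : forall j, tel m (dup_right j l) p) :
  (forall j, G j = H j) -> antider G = antider H.
Proof. by move=> GH; congr antider; exact: functional_extensionality_dep. Qed.

Lemma antiderD m l p (G H : forall j, tel m (dup_right j l) p) :
  antider (fun j => G j + H j) = antider G + antider H.
Proof.
elim: l p G H => [|s l IH] p G H; first exact/esym/addr0.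
apply: tele_ext => X Z; rewrite tele_appD /= -big_split /=.
by apply: eq_bigr => a _; rewrite addrACA -absorbD -IH.
Qed.

Lemma antiderZ m l p a (G : forall j, tel m (dup_right j l) p) :
  antider (fun j => a *: G j) = a *: antider G.
Proof.
elim: l p G => [|s l IH] p G; first exact/esym/scaler0.
apply: tele_ext => X Z; rewrite tele_appZ /= scaler_sumr /=.
by apply: eq_bigr => b _; rewrite scalerDr -absorbZ -IH.
Qed.

Lemma antider_lmul m m' (T : 'M[C]_(m', m)) l p
    (G : forall j, tel m (dup_right j l) p) :
  antider (fun j => tele_lmul T (G j)) = tele_lmul T (antider G).
Proof.
elim: l p G => [|s l IH] p G; first exact/esym/lmul0.
apply: tele_ext => X Z; rewrite lmul_app /= lmul_sum /=.
by apply: eq_bigr => b _; rewrite lmulD lmul_absorb -IH.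
Qed.

Lemma multilinear_antider m l p (G : forall j, tel m (dup_right j l) p) :
  (forall j, multilinear (G j)) -> multilinear (antider G).
Proof.
elim: l p G => [|s l IH] p G mG //= X; set Y := choice_of _.
have mG0 : multilinear (G 0%N : tel m (s :: vslot s :: l) p) by exact: (mG 0%N).
have mGS j : multilinear (G j.+1 : tel m (s :: dup_right j l) p).
  exact: (mG j.+1).
split=> [Z Z'|b Z|Z].
- rewrite -[RHS]/((_ : tel m l _) + _) -big_split /=; apply: eq_bigr => a _.
  rewrite addrACA -absorbD -antiderD rmulmxVDl; congr (tele_absorb _ _ + _).
    by apply: antider_ext => j; rewrite multilinear_appD.
  by rewrite multilinear_appD.
- rewrite -[RHS]/(b *: (_ : tel m l _)) scaler_sumr; apply: eq_bigr => a _.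
  rewrite scalerDr -absorbZ -antiderZ rmulmxVZl; congr (tele_absorb _ _ + _).
    by apply: antider_ext => j; rewrite multilinear_appZ.
  by rewrite multilinear_appZ.
- apply: multilinear_sum => a _; apply: multilinearD.
    by apply/multilinear_absorb/IH => j; exact: multilinear_app.
  exact/(multilinear_app (s := vslot s))/multilinear_app.
Qed.

(** Closedness is unfolded along the list, according to whether each index is 0 or a successor. The
    two sides of each equation then have convertible types. *)
Fixpoint closed m l p : (forall j, tel m (dup_right j l) p) -> Prop :=
  match l return (forall j, tel m (dup_right j l) p) -> Prop with
  | [::] => fun=> True
  | s :: l' => fun G =>
      [/\ Delta_right 0 (G 0%N) = Delta_right 1 (G 0%N)
            :> tel m [:: s, vslot s, vslot s & l'] p,
          forall j, (j < size l')%N ->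
            Delta_right 0 (G j.+1) = Delta_right j.+2 (G 0%N)
              :> tel m [:: s, vslot s & dup_right j l'] p
        & forall X Z, closed (fun j => G j.+1 X Z)]
  end.

(** Here [h] need not be a difference. With A = T X - X' T and B = U X' - Y U one has U T X - Y U T
    = B T + U A. The difference formulas in the two points of [h] produce second differences of [h]
    at the same arguments, one of each kind, and these agree by hypothesis. *)
Lemma closed_cocycle m s l p (h : tel m [:: s, vslot s & l] p)
    (Y X' X : ncpoint (sOm s))
    (U : 'M[C]_(psize Y, psize X')) (T : 'M[C]_(psize X', psize X)) z :
  multilinear h -> respects_right h ->
  Delta_right 0 h = Delta_right 1 h :> tel m [:: s, vslot s, vslot s & l] p ->
  h Y z X (lmulmxV (U *m T) X - rmulmxV Y (U *m T)) =
  tele_absorb T (h Y z X' (lmulmxV U X' - rmulmxV Y U))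
  + (h X' (rmulmxV z U) X (lmulmxV T X - rmulmxV X' T) : tel m l (psize X)).
Proof.
move=> mh rh h01; set A := lmulmxV T X - _; set B := lmulmxV U X' - _.
have -> : lmulmxV (U *m T) X - rmulmxV Y (U *m T) =
    rmulmxV B T + lmulmxV U A.
  rewrite rmulmxVDl rmulNmxV lmulmxVDr lmulmxVN lmulmxVA -lrmulmxVA.
  by rewrite rmulmxVA [RHS]addrC subrKA.
have mhz : multilinear (h Y z : tel m (vslot s :: l) _).
  exact: multilinear_app.
rewrite (multilinear_appD (s := vslot s)) //.
have hU : h X' (rmulmxV z U) X A = (h Y z X (lmulmxV U A) : tel m l _)
    + Delta_right 1 h Y z X' B X A.
  by rewrite (diff_Delta 0 mh rh) h01.
rewrite hU (diff_Delta 0 mhz (proj2 rh Y z) X X' T B).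
by rewrite addrA addrAC.
Qed.

(** In a later slot the defining sum is differenced termwise, by induction. In the first slot
    [delta_contraction] moves [T] to the side of [X], and the cocycle identity splits every
    summand. *)
Lemma diff_antider m l p (G : forall j, tel m (dup_right j l) p) :
  (forall j, multilinear (G j)) -> (forall j, respects_right (G j)) ->
  closed G -> forall j, (j < size l)%N -> diff (antider G) (G j).
Proof.
elim: l p G => [|s l IH] p G mG rG cG j jl; first by [].
have [c00 c0S cS] := cG.
have mG0 : multilinear (G 0%N : tel m (s :: vslot s :: l) p) by exact: (mG 0%N).
have rG0 : respects_right (G 0%N : tel m (s :: vslot s :: l) p).
  exact: (rG 0%N).
have mGS i : multilinear (G i.+1 : tel m (s :: dup_right i l) p).
  exact: (mG i.+1).
have rGS i : respects_right (G i.+1 : tel m (s :: dup_right i l) p).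
  exact: (rG i.+1).
case: j jl => [_|j jl]; last first.
  move=> X Z; set Y := choice_of (inhabits X).
  (* [G j.+1] is brought from [X] to the base point. Closedness turns the correction into a
     difference of [G 0], matching the second summand of [antider]. *)
  have -> : G j.+1 X Z = \sum_(a < psize X)
      (tele_absorb (delta_mx (corner Y) a)
         (G j.+1 Y (rmulmxV Z (delta_mx a (corner Y))))
       + (Delta_right j.+2 (G 0%N) Y (rmulmxV Z (delta_mx a (corner Y))) X
            (lmulmxV (delta_mx (corner Y) a) X
             - rmulmxV Y (delta_mx (corner Y) a))
          : tel m (dup_right j l) (psize X))).
    rewrite {1}(rmulmxV_delta_sum (corner Y) Z) multilinear_app_sum //.
    apply: eq_bigr => a _.
    by rewrite -c0S // (diff_Delta 0 (mGS j) (rGS j)).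
  apply: diff_sum => a _; apply: diffD.
    apply: diff_absorb.
    apply: (IH _ (fun i => G i.+1 Y (rmulmxV Z (delta_mx a (corner Y))))) => //.
    - by move=> i; exact: multilinear_app.
    - by move=> i; exact: (proj2 (rGS i) Y).
    - exact: cS.
  apply: diff_Delta; last exact: (proj2 (proj2 rG0 _ _)).
  exact/(multilinear_app (s := vslot s))/multilinear_app.
move=> X X' T Z; rewrite /= (Prop_irrelevance (inhabits X') (inhabits X)).
set Y := choice_of (inhabits X).
(* The summand of [antider] at [X], as a bilinear map of [z] and [S]. *)
pose phi z S := tele_absorb S (antider (fun j => G j.+1 Y z))
  + (G 0%N Y z X (lmulmxV S X - rmulmxV Y S) : tel m l (psize X)).
have mK z : multilinear (antider (fun j => G j.+1 Y z)).
  by apply: multilinear_antider => j; exact: multilinear_app.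
have mG0Y z : multilinear (G 0%N Y z : tel m (vslot s :: l) _).
  exact: multilinear_app.
apply: etrans (delta_contraction (phi := phi) _ _ _ _ _ _ _) _.
- move=> z z' S; rewrite /phi multilinear_appD // addrACA -absorbD.
  rewrite -antiderD; congr (tele_absorb _ _ + _).
  by apply: antider_ext => j; rewrite multilinear_appD.
- move=> a z S; rewrite /phi multilinear_appZ // scalerDr -absorbZ.
  rewrite -antiderZ; congr (tele_absorb _ _ + _).
  by apply: antider_ext => j; rewrite multilinear_appZ.
- move=> z S S'; rewrite /phi absorbDl // lmulmxVDl rmulmxVDr opprD addrACA.
  by rewrite (multilinear_appD (s := vslot s)) // addrACA.
- move=> a z S; rewrite /phi absorbZl // lmulmxVZl rmulmxVZr -scalemxVN.
  rewrite -scalemxVDr (multilinear_appZ (s := vslot s)) //.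
  by rewrite scalerDr.
have -> : G 0%N X' Z X (lmulmxV T X - rmulmxV X' T) =
    \sum_b (G 0%N X' (rmulmxV (rmulmxV Z (delta_mx b (corner Y)))
      (delta_mx (corner Y) b)) X (lmulmxV T X - rmulmxV X' T) : tel m l _).
  rewrite {1}(rmulmxV_delta_sum (corner Y) Z) multilinear_app_sum //.
  exact: (tele_app_sum (s := vslot s)).
rewrite absorb_sum -big_split; apply: eq_bigr => b _.
(* The cocycle identity is used with [U] the matrix unit [delta_mx (corner Y) b]; summing over [b]
   rebuilds the value at [X'] and the correction. *)
by rewrite /phi closed_cocycle // -absorbA absorbD addrA.
Qed.

End Antiderivative.

(** Quantifying over all proofs [e] allows rewriting with the equality of pairs; proof irrelevance
    then makes the transport along [e] trivial. *)
Lemma existT_inj (I : Type) (P : I -> Type) x (a b : P x) :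
  existT P x a = existT P x b -> a = b.
Proof.
pose Q u v := forall e : projT1 u = projT1 v,
  eq_rect _ P (projT2 u) _ e = projT2 v.
move=> ab; have {ab} : Q (existT P x a) (existT P x b).
  by rewrite ab => e; rewrite (Prop_irrelevance e erefl).
by move/(_ erefl).
Qed.

(** * Closedness and commutation as equalities of dependent pairs *)

Section ClosedFamilies.
Variables (R : realType) (N0 : lmodType R[i]).
Local Notation C := R[i].
Local Notation tel m l p := (tele (mxrows N0 m) l p).
Local Notation telS m p := (existT (fun l => tele (mxrows N0 m) l p)).
Local Notation vslot s := (Slot (sV s) (sOm s)).
Implicit Types (l : seq (slot R)) (m p i j : nat).

Lemma existT_tele_app m s p l l' (f : tel m (s :: l) p)
    (g : tel m (s :: l') p) X Z :
  telS m p (s :: l) f = telS m p (s :: l') g ->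
  telS m (psize X) l (f X Z) = telS m (psize X) l' (g X Z).
Proof.
move=> fg; have [ll'] := projT1_eq fg; rewrite /= in ll'.
by subst l'; rewrite (existT_inj fg).
Qed.

Lemma existT_tele_ext m s p l l' (f : tel m (s :: l) p)
    (g : tel m (s :: l') p) :
  l = l' ->
  (forall X Z, telS m (psize X) l (f X Z) = telS m (psize X) l' (g X Z)) ->
  telS m p (s :: l) f = telS m p (s :: l') g.
Proof.
move=> ll' fg; subst l'; congr existT.
apply: tele_ext => X Z.
exact: (existT_inj (P := fun l => tel m l (psize X)) (fg X Z)).
Qed.

(** If the first index is 0, the lists are convertible and the pairs can be opened. For two
    successors the first slot is stripped. *)
Lemma closed_existT m l p (G : forall j, tel m (dup_right j l) p) :
  (forall i j, (i <= j)%N -> (j < size l)%N ->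
    telS m p _ (Delta_right i (G j)) = telS m p _ (Delta_right j.+1 (G i))) ->
  closed G.
Proof.
elim: l p G => [|s l IH] p G //= hG; split.
- exact: (existT_inj (hG 0%N 0%N _ _)).
- by move=> j jl; exact: (existT_inj (hG 0%N j.+1 _ _)).
- move=> X Z; apply: IH => i j ij jl.
  have := hG i.+1 j.+1 ij jl.
  exact: (@existT_tele_app _ s).
Qed.

Lemma dup_right_comm l i j : (i <= j)%N -> (j < size l)%N ->
  dup_right i (dup_right j l) = dup_right j.+1 (dup_right i l).
Proof.
by elim: l i j => [|s l IH] [|i] [|j] //= ij jl; rewrite IH.
Qed.

(** For two differences in the same slot this is [Delta_right_comm00]. In distinct slots, the
    earlier being the first, the later difference passes through the scaling and absorption that
    define the earlier one. *)
Lemma Delta_right_comm m l p (f : tel m l p) i j :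
  multilinear f -> respects_right f ->
  (forall a, (a < size l)%N -> multilinear (Delta_right a f)) ->
  (forall a, (a < size l)%N -> respects_right (Delta_right a f)) ->
  (i <= j)%N -> (j < size l)%N ->
  telS m p _ (Delta_right i (Delta_right j f)) =
  telS m p _ (Delta_right j.+1 (Delta_right i f)).
Proof.
elim: l p i j f => [|s l IH] p i j f mf rf mD rD ij jl; first by [].
case: i j ij jl => [|i] [|j] // ij jl.
- congr existT; apply: (Delta_right_comm00 (f := f)).
  + exact: (diff_Delta 0 mf rf).
  + exact: (mD 0%N).
  + exact: (rD 0%N).
- congr existT.
  apply: (tele_ext (s := s) (l := vslot s :: dup_right j l)) => X1 Z1.
  apply: (tele_ext (s := vslot s) (l := dup_right j l)) => X2 Z2.
  rewrite [RHS]/= /at_block; set q := cid _.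
  apply: etrans (esym (Delta_rightZ _ _ (tele_absorb _
    (f (NcPoint (svalP q).2) (row_mx Z1 0))))).
  by rewrite Delta_right_absorb.
- apply: existT_tele_ext; first exact: dup_right_comm.
  move=> X Z; apply: IH => //.
  + exact: multilinear_app.
  + exact: (proj2 rf).
  + move=> a al; have mDa := mD a.+1 al.
    have [_ _] := mDa X.
    exact.
  + by move=> a al; exact: (proj2 (rD a.+1 al) X Z).
Qed.

End ClosedFamilies.

(** * The 0-th point *)

Section Hat.
Variables (R : realType) (N0 V0 : lmodType R[i]) (Om0 : ncdom V0).
Local Notation C := R[i].
Local Notation tel m l p := (tele (mxrows N0 m) l p).
Local Notation s0 := (Slot (R[i]^o : lmodType R[i]) Om0).
Implicit Types (l : seq (slot R)) (m p i j : nat).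

(* The extra matrix argument, over C, on the left of X^0 makes the rules for
   the 0-th point instances of those for the other points. *)
Definition hat l p (f : ncfun N0 Om0 l) : tel p (s0 :: l) p :=
  fun X0 Z0 => tele_lmul Z0 (f X0).
#[global] Arguments hat {l} p f.

(** Both branches are [hat]; the case distinction only lets the type [dup_right j (s0 :: l)]
    reduce. *)
Definition hat_dup j l p :
    ncfun N0 Om0 (dup Om0 j l) -> tel p (dup_right j (s0 :: l)) p :=
  match j return ncfun N0 Om0 (dup Om0 j l) ->
      tel p (dup_right j (s0 :: l)) p with
  | 0%N => hat p
  | j'.+1 => hat p
  end.
#[global] Arguments hat_dup j {l} p f.

(** The identity matrix as extra argument recovers [f]. *)
Lemma hat_inj l (f g : ncfun N0 Om0 l) :
  (forall p, hat p f = hat p g) -> f = g.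
Proof.
move=> fg; apply: functional_extensionality_dep => X0.
by rewrite -(lmul1 (f X0)) -(lmul1 (g X0)) -!/(hat _ _ _ 1%:M) fg.
Qed.

Lemma hat_dup_inj j l (f g : ncfun N0 Om0 (dup Om0 j l)) :
  (forall p, hat_dup j p f = hat_dup j p g) -> f = g.
Proof. by case: j f g => [|j] f g; exact: hat_inj. Qed.

Lemma rmulmxV_regular m n p (Z : 'M[C^o]_(m, n)) (T : 'M[C]_(n, p)) :
  rmulmxV Z T = (Z : 'M[C]_(m, n)) *m T.
Proof.
apply/matrixP => i j; rewrite !mxE; apply: eq_bigr => k _.
by rewrite mulrC.
Qed.

Lemma scalemxV_regular m n a (Z : 'M[C^o]_(m, n)) :
  scalemxV a Z = a *: (Z : 'M[C]_(m, n)).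
Proof. by apply/matrixP => i j; rewrite !mxE. Qed.

Lemma multilinear_hat l p (f : ncfun N0 Om0 l) :
  is_nc f -> multilinear (hat p f).
Proof.
move=> [mf _ _] X; split=> [Z Z'|a Z|Z].
- exact: lmulDl.
- by rewrite /hat scalemxV_regular; exact: lmulZl.
- exact/multilinear_lmul/mf.
Qed.

Lemma respects_right_lmul m m' (T : 'M[C]_(m', m)) l p (f : tel m l p) :
  respects_right f -> respects_right (tele_lmul T f).
Proof.
elim: l p f => [|s l IH] p f // [f0 fS]; split; last first.
  by move=> X Z; exact/IH/fS.
move=> X X' S SX Z; rewrite lmul_app f0 //; exact: lmul_absorb.
Qed.

Lemma respects_right_hat l p (f : ncfun N0 Om0 l) :
  is_nc f -> respects_right (hat p f).
Proof.
move=> [_ f0 fS]; split=> [X X' T TX Z|X Z]; last exact/respects_right_lmul/fS.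
by rewrite /hat rmulmxV_regular -lmulA f0 // lmul_absorb.
Qed.

Lemma is_nc_hat l (f : ncfun N0 Om0 l) :
  (forall p, multilinear (hat p f)) -> (forall p, respects_right (hat p f)) ->
  is_nc f.
Proof.
move=> mf rf; split=> [X|X X' T TX|X].
- by rewrite -(lmul1 (f X)); have [_ _] := mf (psize X) X; apply.
- have := proj1 (rf (psize X')) X X' T TX (1%:M : 'M[C]_(psize X')).
  by rewrite /hat rmulmxV_regular mul1mx lmul1.
- by rewrite -(lmul1 (f X)); exact: (proj2 (rf (psize X))).
Qed.

Lemma multilinear_hat_dup j l p (f : ncfun N0 Om0 (dup Om0 j l)) :
  is_nc f -> multilinear (hat_dup j p f).
Proof. by case: j f => [|j] f; exact: multilinear_hat. Qed.

Lemma respects_right_hat_dup j l p (f : ncfun N0 Om0 (dup Om0 j l)) :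
  is_nc f -> respects_right (hat_dup j p f).
Proof. by case: j f => [|j] f; exact: respects_right_hat. Qed.

(** For j = 0 the left factor [1 0] in [Delta] is absorbed by the extra argument: Z1 [1 0] = [Z1 0],
    the argument used by [Delta_right]. *)
Lemma hat_Delta j l p (f : ncfun N0 Om0 l) :
  hat_dup j p (Delta j f) = Delta_right j (hat p f).
Proof.
case: j => [|j].
  apply: (tele_ext (s := s0) (l := Slot V0 Om0 :: l)) => X1 Z1.
  apply: (tele_ext (s := Slot V0 Om0)) => X2 Z.
  rewrite [RHS]/= [LHS]/= /hat /at_block; set q := cid _.
  rewrite lmul_app lmulA -[LHS]/(tele_lmul _ (_ *: _)) lmulZ -lmul_absorb.
  have -> : (Z1 : 'M[C]_(p, psize X1)) *m proj_up R (psize X1) (psize X2) =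
      row_mx Z1 0.
    by rewrite mul_mx_row mulmx1 mulmx0.
  by [].
apply: (tele_ext (s := s0) (l := dup_right j l)) => X1 Z1.
by rewrite /hat /= Delta_right_lmul.
Qed.

Lemma nc_eq_hat l l' p (f : ncfun N0 Om0 l) (g : ncfun N0 Om0 l') :
  nc_eq f g ->
  existT (fun l => tel p l p) (s0 :: l) (hat p f) =
  existT (fun l => tel p l p) (s0 :: l') (hat p g).
Proof.
move=> fg; have ll' := projT1_eq fg; rewrite /= in ll'.
by subst l'; rewrite (existT_inj fg).
Qed.

Lemma hat_nc_eq l l' (f : ncfun N0 Om0 l) (g : ncfun N0 Om0 l') :
  l = l' ->
  (forall p, existT (fun l => tel p l p) (s0 :: l) (hat p f) =
    existT (fun l => tel p l p) (s0 :: l') (hat p g)) ->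
  nc_eq f g.
Proof.
move=> ll' fg; subst l'; congr existT; apply: hat_inj => p.
exact: (existT_inj (fg p)).
Qed.

Lemma existT_hat_Delta i j l p (f : ncfun N0 Om0 (dup Om0 j l)) :
  existT (fun l => tel p l p) _ (Delta_right i (hat_dup j p f)) =
  existT (fun l => tel p l p) _ (hat p (Delta i f)).
Proof.
by case: i j f => [|i] [|j] f; rewrite -[hat_dup _ p f]/(hat p f) -hat_Delta.
Qed.

End Hat.

(** * Closedness as necessary and sufficient condition for an antiderivative *)

Section Integrability.
Variables (R : realType) (N0 V0 : lmodType R[i]) (Om0 : ncdom V0).
Variables (l : seq (slot R)) (n : nat).
Local Notation C := R[i].
Local Notation tel m l p := (tele (mxrows N0 m) l p).
Local Notation s0 := (Slot (R[i]^o : lmodType R[i]) Om0).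
Implicit Types (m p i j : nat).
Variable F : forall j : 'I_n, ncfun N0 Om0 (dup Om0 j l).

(** [antider] takes a family indexed by all natural numbers, so the family is continued by 0. *)
Definition hat_family p j : tel p (dup_right j (s0 :: l)) p :=
  match pselect (j < n)%N with
  | left jn => hat_dup j p (F (Ordinal jn))
  | right _ => 0
  end.

Lemma hat_familyE p (j : 'I_n) : hat_family p j = hat_dup j p (F j).
Proof.
case: j => j jn; rewrite /hat_family; case: pselect => //= jn'.
by rewrite (bool_irrelevance jn' jn).
Qed.

(** Left multiplication commutes with [antider], so the antiderivative of a hatted family is again a
    hat. *)
Lemma antider_hat_family p (X : ncpoint Om0) Z :
  tele_lmul Z (antider (hat_family (psize X)) X 1%:M : tel _ l (psize X)) =
  antider (hat_family p) X Z.
Proof.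
rewrite /= lmul_sum; apply: eq_bigr => a _.
rewrite lmulD lmul_absorb -antider_lmul !rmulmxV_regular mul1mx.
congr (tele_absorb _ _ + _).
  apply: antider_ext => j; rewrite /hat_family.
  by case: pselect => jn; [exact: lmulA | exact: lmul0].
rewrite /hat_family.
by case: pselect => jn; [exact: lmulA | exact: lmul0].
Qed.

Hypothesis nl : n = (size l).+1.
Hypothesis ncF : forall j : 'I_n, is_nc (F j).

(** For every row number [p], [antider] integrates the hatted family. The results are the hats of a
    single [f], and the difference formulas show both that [f] is nc and that its differences are
    the given functions. *)
Lemma antiderivative_exists :
  (forall i j : 'I_n, (i <= j)%N ->
    nc_eq (Delta i (F j)) (Delta j.+1 (F i))) ->
  exists2 f : ncfun N0 Om0 l, is_nc f & forall j : 'I_n, Delta j f = F j.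
Proof.
move=> closedF.
have mG p j : multilinear (hat_family p j).
  rewrite /hat_family; case: pselect => jn; last exact: multilinear0.
  by apply: multilinear_hat_dup; exact: ncF.
have rG p j : respects_right (hat_family p j).
  rewrite /hat_family; case: pselect => jn.
    by apply: respects_right_hat_dup; exact: ncF.
  exact: respects_right0.
have cG p : closed (hat_family p).
  apply: closed_existT => i j ij; rewrite /= -nl => jn.
  have /= -> := hat_familyE p (Ordinal jn).
  have /= -> := hat_familyE p (Ordinal (leq_ltn_trans ij jn)).
  rewrite !existT_hat_Delta; apply: nc_eq_hat.
  exact: (closedF (Ordinal _) (Ordinal _)).
pose f : ncfun N0 Om0 l := fun X => antider (hat_family (psize X)) X 1%:M.
have fE p : hat p f = antider (hat_family p).
  by apply: (tele_ext (s := s0)) => X Z; exact: antider_hat_family.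
have dG p j : (j < n)%N -> diff (hat p f) (hat_family p j).
  by rewrite nl fE => jl; exact: diff_antider.
have mf p : multilinear (hat p f) by rewrite fE; exact: multilinear_antider.
have rf p : respects_right (hat p f).
  apply: (respects_right_diff (G := hat_family p)) => // j.
  by rewrite /= -nl; exact: dG.
exists f; first exact: is_nc_hat.
move=> j; apply: hat_dup_inj => p; rewrite hat_Delta -hat_familyE.
by apply: diff_unique => //; [rewrite /= -nl; exact: ltn_ord | exact: dG].
Qed.

(** Substituting the differences of [f] for [F] and passing to hats leaves the commutation of two
    differences of one function. *)
Lemma Delta_comm (f : ncfun N0 Om0 l) :
  is_nc f -> (forall j : 'I_n, Delta j f = F j) ->
  forall i j : 'I_n, (i <= j)%N ->
    nc_eq (Delta i (F j)) (Delta j.+1 (F i)).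
Proof.
move=> ncf fF i j ij.
have jl : (j <= size l)%N by rewrite -ltnS -nl.
apply: hat_nc_eq; first by rewrite dup_dup // ij.
move=> p; rewrite -existT_hat_Delta.
rewrite -(existT_hat_Delta j.+1 p (F i)) -!fF !hat_Delta.
apply: Delta_right_comm => //.
- exact: multilinear_hat.
- exact: respects_right_hat.
- move=> a; rewrite /= -nl => an.
  have := multilinear_hat_dup p (ncF (Ordinal an)).
  by rewrite -fF hat_Delta.
- move=> a; rewrite /= -nl => an.
  have := respects_right_hat_dup p (ncF (Ordinal an)).
  by rewrite -fF hat_Delta.
Qed.

End Integrability.

(** * Uniqueness *)

Section Uniqueness.
Variables (R : realType) (N0 : lmodType R[i]).
Local Notation C := R[i].
Local Notation tel m l p := (tele (mxrows N0 m) l p).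
Implicit Types (l : seq (slot R)) (m p i j : nat).

Definition single (V : lmodType C) m n (i0 : 'I_m) (j0 : 'I_n) (z : V) :
    'M[V]_(m, n) :=
  \matrix_(i, j) ((((i == i0) && (j == j0))%:R : C) *: z).

Lemma singleD (V : lmodType C) m n (i0 : 'I_m) (j0 : 'I_n) (z z' : V) :
  single i0 j0 (z + z') = single i0 j0 z + single i0 j0 z'.
Proof. by apply/matrixP => i j; rewrite !mxE scalerDr. Qed.

Lemma singleZ (V : lmodType C) m n (i0 : 'I_m) (j0 : 'I_n) a (z : V) :
  single i0 j0 (a *: z) = scalemxV a (single i0 j0 z).
Proof. by apply/matrixP => i j; rewrite !mxE !scalerA mulrC. Qed.

Lemma rmulmxV_delta (V : lmodType C) m n q (Z : 'M[V]_(m, n)) (a : 'I_n)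
    (i0 : 'I_q) :
  rmulmxV Z (delta_mx a i0) = \sum_b single b i0 (Z b a).
Proof.
apply/matrixP => i j; rewrite summxE mxE (bigD1 a) //= big1 ?addr0; last first.
  by move=> k /negPf ka; rewrite mxE ka scale0r.
rewrite (bigD1 i) //= big1 ?addr0; last first.
  by move=> k /negPf ki; rewrite mxE eq_sym ki scale0r.
by rewrite !mxE !eqxx.
Qed.

(** The curried map obtained by evaluating [g] at the base point of each slot, with [z] as the only
    nonzero entry. The default 0 concerns slots without points. *)
Fixpoint corners m l p : tel m l p -> 'I_m -> 'I_p -> curried N0 l :=
  match l return tel m l p -> 'I_m -> 'I_p -> curried N0 l with
  | [::] => fun g al be => (g : 'M[N0]_(m, p)) al be
  | s :: l' => fun g al be z =>
      match pselect (inhabited (ncpoint (sOm s))) with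
      | left h =>
          corners (g (choice_of h) (single be (corner (choice_of h)) z)) al
            (corner (choice_of h))
      | right _ => 0
      end
  end.

Lemma cornersD m l p (f g : tel m l p) al be :
  corners (f + g) al be = corners f al be + corners g al be.
Proof.
elim: l p f g al be => [|s l IH] p f g al be; first exact: mxE.
apply/funext => z /=; rewrite -[RHS]/(_ + _).
by case: pselect => h; [rewrite -IH | rewrite addr0].
Qed.

Lemma cornersZ m l p a (f : tel m l p) al be :
  corners (a *: f) al be = a *: corners f al be.
Proof.
elim: l p f al be => [|s l IH] p f al be; first exact: mxE.
apply/funext => z /=; rewrite -[RHS]/(_ *: _).
by case: pselect => h; [rewrite -IH | rewrite scaler0].
Qed.

Lemma curried_sum s l I (r : seq I) (P : pred I) (G : I -> curried N0 (s :: l))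
    (z : sN s) :
  (\sum_(i <- r | P i) G i : curried N0 (s :: l)) z =
  \sum_(i <- r | P i) (G i z : curried N0 l).
Proof.
exact: (big_morph (fun G : curried N0 (s :: l) => G z : curried N0 l)).
Qed.

Lemma corners_lmul m m' (T : 'M[C]_(m', m)) l p (g : tel m l p) al be :
  corners (tele_lmul T g) al be = \sum_k T al k *: corners g k be.
Proof.
elim: l p g al be => [|s l IH] p g al be; first exact: mxE.
apply/funext => z; rewrite curried_sum /=.
case: pselect => h /=; first exact: IH.
by rewrite big1 // => k _; exact: scaler0.
Qed.

Lemma klinear0 l : klinear (0 : curried N0 l).
Proof.
elim: l => [|s l IH] //; split=> [a z z'|z]; last exact: IH.
by rewrite -[RHS]/(a *: 0 + 0) scaler0 addr0.
Qed.

Lemma klinear_corners m l p (g : tel m l p) al be :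
  multilinear g -> klinear (corners g al be).
Proof.
elim: l p g al be => [|s l IH] p g al be mg //=; split=> [a z z'|z].
  case: pselect => h; last by rewrite scaler0 addr0.
  rewrite singleD singleZ multilinear_appD // multilinear_appZ //.
  by rewrite cornersD cornersZ.
case: pselect => h; last exact: klinear0.
exact/IH/multilinear_app.
Qed.

Lemma klinear_sum s l (c : curried N0 (s :: l)) I (r : seq I) (P : pred I)
    (a : I -> C) (z : I -> sN s) :
  klinear c ->
  c (\sum_(i <- r | P i) a i *: z i) =
  \sum_(i <- r | P i) a i *: (c (z i) : curried N0 l).
Proof.
move=> [cl _].
have c0 : c 0 = 0.
  have := cl 1 0 0; rewrite !scale1r addr0 => /eqP.
  by rewrite -subr_eq subrr eq_sym => /eqP.
apply: (big_ind2 (fun x y => c x = y)) => // [x _ y _ <- <-|i _].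
  by rewrite -[x in LHS]scale1r cl scale1r.
by rewrite -[_ *: _ in LHS]addr0 cl c0 addr0.
Qed.

Lemma sum_ext_sum m l p I (r : seq I) (P : pred I)
    (H : I -> 'I_m -> 'I_p -> curried N0 l) :
  sum_ext (fun al be => \sum_(i <- r | P i) H i al be) =
  \sum_(i <- r | P i) (sum_ext (H i) : tel m l p).
Proof.
elim: l p H => [|s l IH] p H.
  apply/matrixP => al be; rewrite mxE summxE.
  by apply: eq_bigr => i _; rewrite mxE.
apply: tele_ext => X Z; rewrite tele_app_sum /= -IH; congr sum_ext.
apply/funext => al; apply/funext => be.
by rewrite exchange_big /=; apply: eq_bigr => ga _; rewrite curried_sum.
Qed.

(** If a matrix argument is left, the entries of [T] sit inside the next argument of [H]; linearity
    takes them out. *)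
Lemma absorb_sum_ext m l p p' (T : 'M[C]_(p', p))
    (H : 'I_m -> 'I_p' -> curried N0 l) :
  (forall al be, klinear (H al be)) ->
  tele_absorb T (sum_ext H : tel m l p') =
  sum_ext (fun al be => \sum_b T b be *: H al b).
Proof.
case: l H => [|s l] H kH.
  by apply/matrixP => al be; rewrite !mxE; apply: eq_bigr => b _; rewrite mxE.
apply: tele_ext => X Z /=; congr sum_ext.
apply/funext => al; apply/funext => be.
under eq_bigr => b _ do rewrite mxE klinear_sum //.
rewrite exchange_big; apply: eq_bigr => k _ /=.
by rewrite curried_sum.
Qed.

(** Treats [mx_ext] as the extension of the scalar matrix with diagonal [c], uniformly in [l]. *)
Lemma mx_ext_sum_ext m l (c : curried N0 l) :
  mx_ext m c = sum_ext (fun al be => if al == be then c else 0).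
Proof.
case: l c => [|s l] c //; apply: tele_ext => X Z /=; congr sum_ext.
apply/funext => al; apply/funext => be; rewrite (bigD1 al) //= eqxx.
by rewrite big1 ?addr0 // => ga; rewrite eq_sym => /negPf->.
Qed.

(** With vanishing differences, g(X)(Z T) is g(X')(Z) with [T] absorbed for every [T], intertwining
    or not. Decomposing [Z] by matrix units thus moves each slot to its base point, where only
    single entries occur. *)
Lemma sum_ext_corners m l p (g : tel m l p) :
  multilinear g ->
  (forall j, (j < size l)%N -> diff (j := j) g 0) ->
  g = sum_ext (corners g).
Proof.
elim: l p g => [|s l IH] p g mg dg.
  by apply/matrixP => al be; rewrite mxE.
have dg0 X X' T Z : g X (rmulmxV Z T) = tele_absorb T (g X' Z).
  by rewrite (dg 0%N _ X X' T Z) // -[RHS]addr0.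
apply: tele_ext => X Z /=.
case: pselect => [h|]; last by case; exists.
set Y := choice_of h; pose i0 := corner Y.
have gY z : g Y z = sum_ext (corners (g Y z)).
  apply: IH; first exact: multilinear_app.
  by move=> j jl; exact: (dg j.+1 jl).
have kY z al be : klinear (corners (g Y z) al be).
  exact/klinear_corners/multilinear_app.
rewrite {1}(rmulmxV_delta_sum i0 Z) multilinear_app_sum //.
(* Absorbing [delta_mx i0 a] sends column [i0] of the extension at [Y] to column [a], whence the
   factor [(be == a)]. *)
transitivity (\sum_a \sum_b (sum_ext (fun al be =>
    (be == a)%:R *: corners (g Y (single b i0 (Z b a))) al i0) : tel m l _)).
  apply: eq_bigr => a _; rewrite dg0 rmulmxV_delta multilinear_app_sum //.
  rewrite absorb_sum; apply: eq_bigr => b _.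
  rewrite [in LHS]gY absorb_sum_ext //; congr sum_ext.
  apply/funext => al; apply/funext => be.
  rewrite (bigD1 i0) //= mxE eqxx /= big1 ?addr0 // => k /negPf ki.
  by rewrite mxE ki scale0r.
under eq_bigr => a _ do rewrite -sum_ext_sum.
rewrite -sum_ext_sum; congr sum_ext; apply/funext => al; apply/funext => be.
rewrite (bigD1 be) //= [X in _ + X]big1 ?addr0.
  by apply: eq_bigr => b _; rewrite eqxx scale1r.
move=> a /negPf ab; rewrite big1 // => b _.
by rewrite eq_sym ab scale0r.
Qed.

End Uniqueness.

(** The hat of the difference of [f'] and [f] has vanishing differences, so its corner entries
    determine it. *)
Lemma nc_unique (R : realType) (N0 V0 : lmodType R[i]) (Om0 : ncdom V0)
    (l : seq (slot R)) (f f' : ncfun N0 Om0 l) :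
  is_nc f -> is_nc f' ->
  (forall j, (j <= size l)%N -> Delta j f = Delta j f') ->
  exists c : curried N0 l,
    klinear c /\
    forall X0 : ncpoint Om0, f' X0 = tele_add (f X0) (mx_ext (psize X0) c).
Proof.
move=> ncf ncf' ff'.
pose g : ncfun N0 Om0 l := fun X => f' X + -1 *: f X.
have gE p : hat p g = hat p f' + -1 *: hat p f.
  apply: tele_ext => X Z.
  rewrite -[LHS]/(tele_lmul Z (f' X + -1 *: f X)) lmulD lmulZ.
  by [].
have mg p : multilinear (hat p g).
  rewrite gE; apply: multilinearD; first exact: multilinear_hat.
  exact/multilinearZ/multilinear_hat.
have dg p j : (j <= size l)%N -> diff (j := j) (hat p g) 0.
  move=> jl; rewrite gE.
  have -> : 0 = Delta_right j (hat p f') + -1 *: Delta_right j (hat p f).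
    by rewrite -!hat_Delta ff' // scaleN1r subrr.
  apply: diffD; last apply: diffZ.
    by apply: diff_Delta; [exact: multilinear_hat|exact: respects_right_hat].
  by apply: diff_Delta; [exact: multilinear_hat|exact: respects_right_hat].
have mgX X : multilinear (g X).
  apply: multilinearD; first by case: ncf'.
  by apply: multilinearZ; case: ncf.
have [h|noX] := pselect (inhabited (ncpoint Om0)); last first.
  exists 0; split=> [|X]; first exact: klinear0.
  by case: noX; exists.
pose Y := choice_of h; pose i0 := corner Y.
exists (corners (g Y) i0 i0); split=> [|X]; first exact: klinear_corners.
have -> : f' X = f X + g X by rewrite /g scaleN1r addrC subrK.
rewrite -[RHS]/(_ + _); congr (_ + _).
rewrite mx_ext_sum_ext.
have -> : g X = hat (psize X) g X 1%:M by rewrite /hat lmul1.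
rewrite (sum_ext_corners (mg (psize X)) (dg (psize X))) /=.
congr sum_ext; apply/funext => al; apply/funext => be.
(* The extra argument is the identity, with entries [(ga == be)], and the single entry placed in row
   [ga] contributes [(al == ga)]. Their sum over [ga] is the identity matrix. *)
transitivity (\sum_(ga < psize X)
    ((al == ga)%:R * (ga == be)%:R : R[i]) *: corners (g Y) i0 i0).
  apply: eq_bigr => ga _; case: pselect => [h'|]; last by case.
  rewrite (Prop_irrelevance h' h) /hat corners_lmul (bigD1 i0) //=.
  rewrite big1 ?addr0; last first.
    by move=> k /negPf ki; rewrite mxE ki andbF !scale0r.
  by rewrite !mxE eqxx andbT.
rewrite (bigD1 al) //= eqxx mul1r big1 ?addr0; last first.
  by move=> ga; rewrite eq_sym => /negPf ->; rewrite mul0r scale0r.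
by case: (al == be); rewrite ?scale1r ?scale0r.
Qed.

(** * Analyticity on slices *)

Section PowerSeries.
Local Open Scope classical_set_scope.
Variables (R : realType) (N0 : lmodType R[i]) (m n : nat).
Local Notation C := R[i].
Variable nrm : 'M[N0]_(m, n) -> C.
Hypothesis nrmP : is_norm nrm.

Lemma is_norm0 : nrm 0 = 0.
Proof. by case: nrmP => _ nZ _; rewrite -(scale0mxV 0) nZ normr0 mul0r. Qed.

(** The triangle inequality for A - A gives 0 at most twice the norm of A. *)
Lemma is_norm_ge0 A : 0 <= nrm A.
Proof.
case: nrmP => nD nZ _.
have := nD A (scalemxV (-1) A).
rewrite nZ normrN1 mul1r -{1}[A]scale1mxV -scalemxVDl subrr scale0mxV is_norm0.
by rewrite -mulr2n pmulrn_lge0.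
Qed.

(** The order of the complex field is partial; positive elements are real, hence comparable. *)
Lemma exists_lower_radius (r1 r2 : C) : 0 < r1 -> 0 < r2 ->
  exists2 r, 0 < r & r <= r1 /\ r <= r2.
Proof.
move=> r1_gt0 r2_gt0.
have [r12|r21] := real_leP (gtr0_real r1_gt0) (gtr0_real r2_gt0).
  by exists r1.
by exists r2 => //; split=> //; exact: ltW.
Qed.

Lemma analytic_near0_mono (D D' : C -> Prop)
    (g : forall t, D t -> 'M[N0]_(m, n)) (g' : forall t, D' t -> 'M[N0]_(m, n))
    (r : C) :
  0 < r -> (forall t, `|t| < r -> D t -> D' t) ->
  (forall t h h', g' t h' = g t h) ->
  analytic_near0 nrm g -> analytic_near0 nrm g'.
Proof.
move=> r0 DD' gg' [rho [a [rho0 ha]]].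
have [s s0 [sr srho]] := exists_lower_radius r0 rho0.
exists s, a; split=> // t ts.
have [h hcvg] := ha t (lt_le_trans ts srho).
exists (DD' t (lt_le_trans ts sr) h).
by under eq_fun => M do rewrite (gg' t h).
Qed.

Lemma analytic_near0_cst (D : C -> Prop) (A : 'M[N0]_(m, n)) (r : C) :
  0 < r -> (forall t, `|t| < r -> D t) ->
  analytic_near0 nrm (fun t (_ : D t) => A).
Proof.
move=> r0 rD; exists r, (fun i => if i == 0%N then A else 0); split=> // t tr.
exists (rD t tr); apply: cvg_near_cst; near=> M.
(* The empty partial sum lacks the constant term, so the remainder vanishes only from M = 1 on. *)
have M0 : (0 < M)%N by near: M; exact: nbhs_infty_gt.
rewrite -(prednK M0) big_ord_recl /= expr0 scale1mxV big1 ?addr0.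
  by rewrite subrr is_norm0.
by move=> i _; rewrite scalemxV0.
Unshelve. all: by end_near. Qed.

Lemma cvg0_le (u v : nat -> C^o) :
  (forall k, `|u k| <= v k) -> v @ \oo --> (0 : C^o) -> u @ \oo --> (0 : C^o).
Proof.
move=> uv v0; apply/cvgr0Pnorm_lt => e e0.
move/cvgr0Pnorm_lt : v0 => /(_ e e0); apply: filterS => k.
by apply: le_lt_trans; rewrite [`|v k|]ger0_norm // (le_trans _ (uv k)).
Qed.

Lemma analytic_near0D (D : C -> Prop) (g g' : forall t, D t -> 'M[N0]_(m, n)) :
  analytic_near0 nrm g -> analytic_near0 nrm g' ->
  analytic_near0 nrm (fun t h => g t h + g' t h).
Proof.
move=> [r [a [r0 ha]]] [r' [a' [r'0 ha']]].
have [s s0 [sr sr']] := exists_lower_radius r0 r'0.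
exists s, (fun i => a i + a' i); split=> // t ts.
have [h hcvg] := ha t (lt_le_trans ts sr).
have [h' hcvg'] := ha' t (lt_le_trans ts sr').
exists h; rewrite (Prop_irrelevance h' h) in hcvg'.
apply: (@cvg0_le _ (fun M : nat =>
  nrm (g t h - \sum_(i < M) scalemxV (t ^+ i) (a i)) +
  nrm (g' t h - \sum_(i < M) scalemxV (t ^+ i) (a' i)))) => [M|].
  rewrite ger0_norm ?is_norm_ge0 //.
  have -> : \sum_(i < M) scalemxV (t ^+ i) (a i + a' i) =
      \sum_(i < M) scalemxV (t ^+ i) (a i) +
      \sum_(i < M) scalemxV (t ^+ i) (a' i).
    by rewrite -big_split; apply: eq_bigr => i _; exact: scalemxVDr.
  by rewrite opprD addrACA; case: nrmP.
have e0 : (0 : C^o) + 0 = 0 by rewrite addr0.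
by have := cvgD hcvg hcvg'; rewrite e0; exact.
Qed.

Lemma analytic_near0_scale (D : C -> Prop)
    (g : forall t, D t -> 'M[N0]_(m, n)) :
  analytic_near0 nrm g ->
  analytic_near0 nrm (fun t h => scalemxV t (g t h)).
Proof.
move=> [r [a [r0 ha]]].
(* Multiplication by [t] shifts the coefficients by one. The remainder after M + 1 terms is [t]
   times the old remainder after M terms. *)
exists r, (fun i => if i is i'.+1 then a i' else 0); split=> // t tr.
have [h hcvg] := ha t tr; exists h.
rewrite -cvg_shiftS.
have hM M : nrm (scalemxV t (g t h) -
    \sum_(i < M.+1) scalemxV (t ^+ i) (if val i is i'.+1 then a i' else 0)) =
    `|t| * nrm (g t h - \sum_(i < M) scalemxV (t ^+ i) (a i)).
  case: nrmP => _ <- _; rewrite scalemxVDr scalemxVN scalemxV_sum.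
  rewrite big_ord_recl scalemxV0 add0r; congr (nrm (_ - _)).
  by apply: eq_bigr => i _; rewrite scalemxVA -exprS.
under eq_fun => M do rewrite hM.
have e0 : (`|t| : C^o) * 0 = 0 by rewrite mulr0.
by have := cvgM (cvg_cst (`|t| : C^o)) hcvg; rewrite e0; exact.
Qed.

End PowerSeries.

(** * Slices through several points *)

Section Slices.
Variables (R : realType) (N0 : lmodType R[i]) (nu : matnorms N0).
Local Notation C := R[i].
Local Notation tel m l p := (tele (mxrows N0 m) l p).
Implicit Types (l : seq (slot R)) (m p i j : nat).
Hypothesis nuP : forall p q, (0 < p)%N -> (0 < q)%N -> is_norm (@nu p q).

Lemma psize_gt0 (V : lmodType C) (Om : ncdom V) (X : ncpoint Om) :
  (0 < psize X)%N.
Proof. exact: ncdom_gt0 (pval_in X). Qed.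

Lemma slice_analytic_mono m l p (D D' : C -> Prop)
    (g : forall t, D t -> tel m l p) (g' : forall t, D' t -> tel m l p)
    (r : C) :
  0 < r -> (forall t, `|t| < r -> D t -> D' t) ->
  (forall t h h', g' t h' = g t h) ->
  slice_analytic nu g -> slice_analytic nu g'.
Proof.
move=> r0; elim: l p D D' g g' => [|s l IH] p D D' g g' DD' gg'.
  exact: (analytic_near0_mono r0 DD' gg').
move=> ag Y Z Wm; apply: IH (ag Y Z Wm) => [t tr [h hO]|t h h'].
  by split=> //; exact: DD'.
by rewrite (gg' t h.1 h'.1) (Prop_irrelevance h'.2 h.2).
Qed.

Lemma slice_analyticD m l p (D : C -> Prop)
    (g g' : forall t, D t -> tel m l p) :
  (0 < m)%N -> (0 < p)%N ->
  slice_analytic nu g -> slice_analytic nu g' ->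
  slice_analytic nu (fun t h => g t h + g' t h).
Proof.
move=> m0; elim: l p D g g' => [|s l IH] p D g g' p0.
  exact/analytic_near0D/nuP.
move=> ag ag' Y Z Wm.
exact: (IH _ _ _ _ (psize_gt0 Y) (ag Y Z Wm) (ag' Y Z Wm)).
Qed.

Lemma slice_analytic_scale m l p (D : C -> Prop)
    (g : forall t, D t -> tel m l p) :
  (0 < m)%N -> (0 < p)%N ->
  slice_analytic nu g -> slice_analytic nu (fun t h => t *: g t h).
Proof.
move=> m0; elim: l p D g => [|s l IH] p D g p0.
  exact/analytic_near0_scale/nuP.
move=> ag Y Z Wm; exact: (IH _ _ _ (psize_gt0 Y) (ag Y Z Wm)).
Qed.

Fixpoint all_inhabited l : Prop :=
  match l with
  | [::] => True
  | s :: l' => inhabited (ncpoint (sOm s)) /\ all_inhabited l'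
  end.

(** A slot without points makes analyticity vacuous, so all slots may be assumed to have points. *)
Lemma slice_analytic_inhabited m l p (D : C -> Prop)
    (g : forall t, D t -> tel m l p) :
  (all_inhabited l -> slice_analytic nu g) -> slice_analytic nu g.
Proof.
elim: l p D g => [|s l IH] p D g ag; first exact: ag.
by move=> Y Z Wm; apply: IH => hl; apply: ag; split=> //; exists.
Qed.

(** Choosing a point with direction 0 in every slot leads to [analytic_near0], which includes a disc
    inside the accumulated domain. *)
Lemma slice_analytic_dom m l p (D : C -> Prop)
    (g : forall t, D t -> tel m l p) :
  all_inhabited l -> slice_analytic nu g ->
  exists2 r : C, 0 < r & forall t, `|t| < r -> D t.
Proof.
elim: l p D g => [|s l IH] p D g.
  by move=> _ [r [a [r0 ha]]]; exists r => // t /ha[].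
move=> [[Y] hl] /(_ Y 0 0)/(IH _ _ _ hl)[r r0 rD].
by exists r => // t /rD[].
Qed.

(** Direction 0 freezes a point, so slices may move only some of the points. The family [T] allows
    for the different types of the remaining arguments. *)
Lemma slice0 (T : nat -> Type) (V : lmodType C) (Om : ncdom V)
    (f : forall X : ncpoint Om, T (psize X)) (Y : ncpoint Om) t
    (h : Om (psize Y) (pval Y + scalemxV t 0)) :
  f (NcPoint h) = f Y.
Proof.
move: h; rewrite scalemxV0 addr0; case: Y => n A hA h /=.
by rewrite (Prop_irrelevance h hA).
Qed.

(* f(Y + tZ) = f(Y) + t Delta_0 f(Y, Y + tZ)(Z), slot by slot. *)
Lemma slice_analytic_cst m l p (D : C -> Prop) (r : C) (f : tel m l p) :
  (0 < m)%N -> (0 < p)%N -> 0 < r -> (forall t, `|t| < r -> D t) ->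
  multilinear f -> respects_right f ->
  (forall j, (j < size l)%N -> multilinear (Delta_right j f)) ->
  (forall j, (j < size l)%N ->
    slice_analytic nu (fun t (_ : D t) => Delta_right j f)) ->
  slice_analytic nu (fun t (_ : D t) => f).
Proof.
move=> m0; elim: l p D r f => [|s l IH] p D r f p0 r0 rD mf rf mDf aDf.
  exact: (analytic_near0_cst (nuP m0 p0) f r0 rD).
have mD0 : multilinear (Delta_right 0 f) := mDf 0%N isT.
move=> Y Z Wm; apply: slice_analytic_inhabited => hl.
(* The disc comes from the slice of the 0-th difference whose first point moves in direction [Z]. *)
have [r1 r10 r1D] : exists2 r : C, 0 < r & forall t, `|t| < r ->
    D t /\ sOm s (psize Y) (pval Y + scalemxV t Z).
  apply: (slice_analytic_dom (l := Slot (sV s) (sOm s) :: l)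
    _ (aDf 0%N isT Y Z Wm)).
  by split=> //; exists.
set D1 := fun t => _ in r1D *.
have aY : slice_analytic nu (fun t (_ : D1 t) => f Y Wm : tel m l (psize Y)).
  apply: (IH _ _ r1) => //.
  - exact: psize_gt0.
  - exact: multilinear_app.
  - exact: (proj2 rf).
  - move=> j jl; have [_ _] := mDf j.+1 jl Y.
    exact.
  (* The differences of [f Y Wm] are later differences of [f] with the first point frozen at [Y]. *)
  - move=> j jl; apply: slice_analytic_mono (aDf j.+1 jl Y 0 Wm).
    + exact: r10.
    + by move=> t tr1 _; exact: r1D.
    + move=> t h h'.
      have := slice0 (T := fun n => 'M[sN s]_(p, n) -> tel m (dup_right j l) n)
        (Delta_right j.+1 f) h.2.
      by move/(congr1 (fun F => F Wm)).
(* Of the two copies of [Y] the first is frozen and the second moves along [Z], with [Z] also as the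
   inserted argument. *)
have a0 : slice_analytic nu (fun t (h : D1 t) =>
    Delta_right 0 f Y Wm (NcPoint h.2) Z : tel m l (psize Y)).
  apply: slice_analytic_mono (aDf 0%N isT Y 0 Wm Y Z Z).
  - exact: r10.
  - by move=> t tr1 _; exact: r1D.
  - move=> t h h'.
    pose T n := 'M[sN s]_(p, n) -> forall X : ncpoint (sOm s),
      'M[sV s]_(n, psize X) -> tel m l (psize X).
    have := slice0 (T := T) (Delta_right 0 f) h.1.2.
    move/(congr1 (fun F : T (psize Y) => F Wm (NcPoint h.2) Z)) => /esym.
    by rewrite (Prop_irrelevance h'.2 h.2).
apply: slice_analytic_mono r10 _ _
  (slice_analyticD m0 (psize_gt0 Y) aY
    (slice_analytic_scale m0 (psize_gt0 Y) a0)) => //.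
move=> t h h'; rewrite (Prop_irrelevance h' h).
(* For T = 1 the correction has the argument (Y + t Z) - Y = t Z, and linearity takes out [t]. *)
have := diff_Delta 0 mf rf (NcPoint h.2) Y (1%:M : 'M_(psize Y)) Wm.
rewrite rmulmxV1 absorb1 lmul1mxV rmulmxV1.
rewrite -[pval (NcPoint h.2)]/(pval Y + scalemxV t Z) addrAC subrr add0r => ->.
rewrite (multilinear_appZ (s := Slot (sV s) (sOm s))) //.
exact: multilinear_app.
Qed.

End Slices.

(** The 0-th point moves by f(Y + t Z) = f(Y) + t Delta_0 f(Y, Y + t Z)(Z), obtained from the hat at
    the identity. For fixed [Y] the other points are handled by [slice_analytic_cst]. *)
Lemma W_analytic_Delta (R : realType) (N0 V0 : lmodType R[i])
    (nu : matnorms N0) (Om0 : ncdom V0) (l : seq (slot R))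
    (f : ncfun N0 Om0 l) :
  (forall p q, (0 < p)%N -> (0 < q)%N -> is_norm (@nu p q)) ->
  is_nc f ->
  (forall j, (j <= size l)%N -> is_nc (Delta j f)) ->
  (forall j, (j <= size l)%N -> W_analytic nu (Delta j f)) ->
  W_analytic nu f.
Proof.
move=> nuP ncf ncD aD Y Z; apply: slice_analytic_inhabited => hl.
have Y0 := psize_gt0 Y.
have [r r0 rD] : exists2 r : R[i], 0 < r & forall t, `|t| < r ->
    Om0 (psize Y) (pval Y + scalemxV t Z).
  apply: (slice_analytic_dom (l := Slot V0 Om0 :: l) _ (aD 0%N isT Y Z)).
  by split=> //; exists.
have [mf _ rf] := ncf; have [mD0 _ _] := ncD 0%N isT.
set D := fun t => _ in rD *.
have aY : slice_analytic nu (fun t (_ : D t) =>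
    f Y : tele (mxrows N0 _) l (psize Y)).
  apply: (slice_analytic_cst nuP Y0 Y0 r0 rD (mf Y) (rf Y)) => j jl.
    by have [mDj _ _] := ncD j.+1 jl; exact: mDj.
  apply: slice_analytic_mono (aD j.+1 jl Y 0).
  - exact: r0.
  - by move=> t tr _; exact: rD.
  - move=> t h h'; apply: esym.
    exact: (slice0 (T := fun n => tele (mxrows N0 n) (dup_right j l) n)
      (Delta j.+1 f) h).
have a0 : slice_analytic nu (fun t (h : D t) =>
    Delta 0 f Y (NcPoint h) Z : tele (mxrows N0 _) l (psize Y)).
  apply: slice_analytic_mono (aD 0%N isT Y 0 Y Z Z).
  - exact: r0.
  - by move=> t tr _; exact: rD.
  - move=> t h h'.
    pose T n := forall X : ncpoint Om0,
      'M[V0]_(n, psize X) -> tele (mxrows N0 n) l (psize X).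
    have := slice0 (T := T) (Delta 0 f) h.1.
    move/(congr1 (fun F : T (psize Y) => F (NcPoint h.2) Z)) => /esym.
    by rewrite (Prop_irrelevance h' h.2).
apply: slice_analytic_mono r0 _ _
  (slice_analyticD nuP Y0 Y0 aY (slice_analytic_scale nuP Y0 Y0 a0)) => //.
move=> t h h'; rewrite (Prop_irrelevance h' h).
have := diff_Delta 0 (multilinear_hat (psize Y) ncf)
  (respects_right_hat (psize Y) ncf) (NcPoint h) Y (1%:M : 'M_(psize Y)) 1%:M.
rewrite rmulmxV1 absorb1 lmul1mxV rmulmxV1 -hat_Delta.
rewrite -[pval (NcPoint h)]/(pval Y + scalemxV t Z) addrAC subrr add0r.
rewrite /hat_dup /hat !lmul1 => ->.
by rewrite (multilinear_appZ (s := Slot V0 Om0)).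
Qed.

Theorem theorem3p4 (R : realType) (k : nat) (hk : (0 < k)%N)
  (V : 'I_k.+1 -> lmodType R[i])
  (W : 'I_k.+1 -> completeNormedModType R[i])
  (nu : forall j : 'I_k.+1, matnorms (W j))
  (hnu : forall j : 'I_k.+1, admissible_norms (nu j))
  (Om : forall j : 'I_k.+1, ncdom (V j))
  (hOm : forall j : 'I_k.+1, finitely_open (Om j))
  (F : forall j : 'I_k.+1,
     ncfun (W ord0) (Om ord0) (dup (Om ord0) j (slots W Om)))
  (hF : forall j : 'I_k.+1, is_nc (F j))
  (aF : forall j : 'I_k.+1, W_analytic (nu ord0) (F j)) :
  let solution (f : ncfun (W ord0) (Om ord0) (slots W Om)) :=
    [/\ is_nc f, W_analytic (nu ord0) f
      & forall j : 'I_k.+1, Delta j f = F j] in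
  ((exists f, solution f) <->
   (forall i j : 'I_k.+1, (i <= j)%N ->
      nc_eq (Delta i (F j)) (Delta j.+1 (F i))))
  /\
  (forall f f', solution f -> solution f' ->
     exists c : curried (W ord0) (slots W Om),
       klinear c /\
       forall X0 : ncpoint (Om ord0),
         f' X0 = tele_add (f X0) (mx_ext (psize X0) c)).
Proof.
move=> solution.
(* There are k slots after the 0-th point, hence k + 1 differences. *)
have sz : k.+1 = (size (slots W Om)).+1 by rewrite size_map size_enum_ord.
split; first split.
- by move=> [f [ncf _ fF]]; exact: (Delta_comm sz hF ncf fF).
- move=> closedF; have [f ncf fF] := antiderivative_exists sz hF closedF.
  (* Analyticity of [f] follows from that of its differences, which are the [F j]. *)
  exists f; split=> //; apply: W_analytic_Delta => //.
  + by have [] := hnu ord0.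
  + move=> j; rewrite -ltnS -sz => jk; rewrite (fF (Ordinal jk)); exact: hF.
  + move=> j; rewrite -ltnS -sz => jk; rewrite (fF (Ordinal jk)); exact: aF.
- move=> f f' [ncf _ fF] [ncf' _ f'F]; apply: nc_unique => // j.
  by rewrite -ltnS -sz => jk; rewrite (fF (Ordinal jk)) (f'F (Ordinal jk)).
Qed.
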